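(* Let $S_1\subseteq\mathbb{R}[\underline x]$ and $S_2\subseteq\mathscr{M}$, and suppose $\operatorname{QM}(S_1)$ is archimedean in $\mathbb{R}[\underline x]$. (1) For $f\in\mathscr{M}[\underline x]$ the following are equivalent: (i) $f(\mu,\underline X)\ge0$ for all $(\mu,\underline X)\in\mathbf{K}(S_1,S_2)\times K(S_1)$; (ii) $f+\varepsilon\in\operatorname{QM}(S_1,S_2)$ for all $\varepsilon>0$. (2) For $f\in\mathscr{M}$ the following are equivalent: (i') $f(\mu)\ge0$ for all $\mu\in\mathbf{K}(S_1,S_2)$; (ii') $f+\varepsilon\in\operatorname{qm}(S_1,S_2)$ for all $\varepsilon>0$.
   Context: Let $n\in\mathbb{N}$ and $\mathbb{R}[\underline x]=\mathbb{R}[x_1,\dots,x_n]$. Let $\mathscr{M}=\mathbb{R}[\mathtt{m}_{i_1,\dots,i_n}\colon (i_1,\dots,i_n)\in\mathbb{N}_0^n]$ be the polynomial ring in countably many indeterminates (formal moments), with the convention $\mathtt{m}_{0,\dots,0}:=1$, and let $\mathscr{M}[\underline x]=\mathscr{M}\otimes_{\mathbb{R}}\mathbb{R}[\underline x]$. Let $\mathtt{m}:\mathscr{M}[\underline x]\to\mathscr{M}$ be the unique $\mathscr{M}$-linear map with $\mathtt{m}(x_1^{i_1}\cdots x_n^{i_n})=\mathtt{m}_{i_1,\dots,i_n}$. A quadratic module in a commutative unital ring $A$ is a subset $M$ with $1\in M$, $M+M\subseteq M$ and $a^2M\subseteq M$ for all $a\in A$; it is archimedean if for every $a\in A$ there is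 $N\in\mathbb{N}$ with $N\pm a\in M$. For $S_1\subseteq\mathbb{R}[\underline x]$, $S_2\subseteq\mathscr{M}$: $\operatorname{QM}(S_1)$ is the quadratic module of $\mathbb{R}[\underline x]$ generated by $S_1$; $\operatorname{qm}(S_1,S_2)$ is the quadratic module of $\mathscr{M}$ generated by $\{\mathtt{m}(f^2s)\colon s\in\{1\}\cup S_1,\ f\in\mathscr{M}[\underline x]\}\cup S_2$; $\operatorname{QM}(S_1,S_2)$ is the quadratic module of $\mathscr{M}[\underline x]$ generated by $S_1\cup\{\mathtt{m}(f^2s)\colon s\in\{1\}\cup S_1,\ f\in\mathscr{M}[\underline x]\}\cup S_2$. For closed $K\subseteq\mathbb{R}^n$, $\mathbf{P}(K)$ denotes the set of Borel probability measures on $\mathbb{R}^n$ supported on $K$ with $\int x_j^{2k}\,d\mu<\infty$ for all $j$ and $k\in\mathbb{N}$. For $(\mu,\underline X)\in\mathbf{P}(\mathbb{R}^n)\times\mathbb{R}^n$ and $f\in\mathscr{M}[\underline x]$, $f(\mu,\underline X)$ is the image of $f$ under the ring homomorphism $\mathscr{M}[\underline x]\to\mathbb{R}$ determined by $\mathtt{m}_{i_1,\dots,i_n}\mapsto\int x_1^{i_1}\cdots x_n^{i_n}\,d\mu$ and $x_j\mapsto X_j$; for $f\in\mathscr{M}$ this depends only on $\mu$ and is written $f(\mu)$. Set $K(S_1)=\{\underline X\in\mathbb{R}^n\colon p(\underline X)\ge0\ \forall p\in S_1\}$ and $\mathbf{K}(S_1,S_2)=\{\mu\in\mathbf{P}(K(S_1))\colon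 s(\mu)\ge0\ \forall s\in S_2\}$. *)

(* Defs.v *)
From HB Require Import structures.
From mathcomp Require Import all_boot all_order all_algebra.
From mathcomp Require Import finmap.
From mathcomp Require Import monalg.
From mathcomp Require Import all_classical all_reals all_analysis.

Set Implicit Arguments.
Unset Strict Implicit.
Unset Printing Implicit Defensive.

Import Order.TTheory GRing.Theory Num.Theory.
Import numFieldNormedType.Exports.
Local Open Scope classical_set_scope.
Local Open Scope ring_scope.

Notation polyring R I := (monalg.malg (monalg.cmonom I) R).

Definition pvar (R : comNzRingType) (I : choiceType) (i : I) : polyring R I :=
  monalg.mkmalgU (monalg.ucm i) 1.

Definition pconst (R : comNzRingType) (I : choiceType) (c : R) : polyring R I :=
  monalg.mkmalgU (monalg.onecm I) c.

Definition monval (S : comNzRingType) (I : choiceType) (v : I -> S)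
  (k : monalg.cmonom I) : S :=
  \prod_(i <- finsupp (monalg.cmonom_val k)) v i ^+ monalg.cmonom_val k i.

Definition peval (R : comNzRingType) (I : choiceType) (v : I -> R)
  (p : polyring R I) : R :=
  monalg.mmap idfun (monval v) p.

Definition psubst (R : comNzRingType) (I J : choiceType) (v : I -> polyring R J)
  (p : polyring R I) : polyring R J :=
  monalg.mmap (@pconst R J) (monval v) p.

Definition is_qmodule (A : comNzRingType) (M : set A) : Prop :=
  [/\ M 1, (forall x y, M x -> M y -> M (x + y))
     & (forall a x, M x -> M (a ^+ 2 * x))].

Definition qmgen (A : comNzRingType) (G : set A) : set A :=
  fun x => forall M : set A, is_qmodule M -> G `<=` M -> M x.

Definition qm_archimedean (A : comNzRingType) (M : set A) : Prop :=
  forall a : A, exists N : nat, M (N%:R + a) /\ M (N%:R - a).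

Definition mindex (n : nat) := {ffun 'I_n -> nat}.
(* indices of the formal moments that are genuine indeterminates:
   m_{0,...,0} := 1 is not an indeterminate *)
Definition momvar (n : nat) := {a : mindex n | a != [ffun => 0%N]}.

Notation Rx R n := (polyring R 'I_n).
Notation Mr R n := (polyring R (momvar n)).
(* scrM[x] = scrM (x) R[x] = R[m_a, x_j] *)
Notation Mx R n := (polyring R (momvar n + 'I_n)%type).

Section Rings.
Variables (R : realType) (n : nat).

Local Notation mindex := (mindex n).
Local Notation momvar := (momvar n).

Local Notation Rx := (polyring R 'I_n).
Local Notation Mr := (polyring R momvar).
Local Notation Mx := (polyring R (momvar + 'I_n)%type).

Definition mom (a : mindex) : Mr :=
  match insub a with Some b => pvar R b | None => 1 end.

Definition Rx_to_Mx : Rx -> Mx := psubst (fun j => pvar R (inr j)).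
Definition Mr_to_Mx : Mr -> Mx := psubst (fun b => pvar R (inl b)).

(* the scrM-linear map m : scrM[x] -> scrM with m(x^a) = m_a:
   a monomial  prod m_b^{k_b} * prod x_j^{k_j}  is sent to
   (prod m_b^{k_b}) * m_{(k_j)_j}                                          *)
Definition mlin_mon (k : monalg.cmonom (momvar + 'I_n)%type) : Mr :=
  monval (fun i => match i with inl b => pvar R b | inr _ => 1 end) k
  * mom [ffun j => monalg.cmonom_val k (inr j)].

Definition mlin (f : Mx) : Mr := monalg.mmap (@pconst R _) mlin_mon f.

Definition mgens (S1 : set Rx) : set Mr :=
  [set y | exists (f s : Mx),
     ([set 1] `|` (Rx_to_Mx @` S1)) s /\ y = mlin (f ^+ 2 * s)].

Definition QM1 (S1 : set Rx) : set Rx := qmgen S1.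
Definition qm2 (S1 : set Rx) (S2 : set Mr) : set Mr :=
  qmgen (mgens S1 `|` S2).
Definition QM2 (S1 : set Rx) (S2 : set Mr) : set Mx :=
  qmgen ((Rx_to_Mx @` S1) `|` (Mr_to_Mx @` (mgens S1 `|` S2))).

Definition Rn := g_sigma_algebraType (@open 'rV[R]_n).

Definition xmon (a : mindex) (x : Rn) : R := \prod_(j < n) x ord0 j ^+ a j.

Definition moment (mu : probability Rn R) (a : mindex) : R :=
  Rintegral mu setT (xmon a).

Definition finite_moments (mu : probability Rn R) : Prop :=
  forall (j : 'I_n) (k : nat),
    mu.-integrable setT (fun x : Rn => (x ord0 j ^+ (2 * k))%:E).

Definition PK (K : set 'rV[R]_n) : set (probability Rn R) :=
  [set mu | finite_moments mu /\ mu (~` K) = 0%E].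

Definition evalM (mu : probability Rn R) (f : Mr) : R :=
  peval (fun b : momvar => moment mu (val b)) f.

Definition evalMx (mu : probability Rn R) (X : 'rV[R]_n) (f : Mx) : R :=
  peval (fun i => match i with
                  | inl b => moment mu (val b)
                  | inr j => X ord0 j end) f.

Definition evalRx (X : 'rV[R]_n) (p : Rx) : R := peval (fun j => X ord0 j) p.

Definition KS1 (S1 : set Rx) : set 'rV[R]_n :=
  [set X | forall p, S1 p -> 0 <= evalRx X p].

Definition KS12 (S1 : set Rx) (S2 : set Mr) : set (probability Rn R) :=
  [set mu | PK (KS1 S1) mu /\ forall s, S2 s -> 0 <= evalM mu s].

End Rings.

(* Main.v *)
(* Both parts reduce to a representation theorem: if an archimedean quadratic module
   [M] in a commutative R-algebra does not contain [f + e], then some R-algebra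
   character that is nonnegative on [M] takes a negative value at [f].  The
   character comes from a maximal proper quadratic module [Q] containing [M] and
   [- (f + e)]: such a [Q] satisfies [Q \cup -Q = A], and
   [a |-> sup {r | a - r \in Q}] is multiplicative by Cauchy-Schwarz.

   [qm2] and [QM2] are archimedean, because [N +- x^a \in QM1 S1] gives
   [N +- m_a = mlin (N +- x^a) \in qm2].  A character of the moment polynomials that
   is nonnegative on [qm2] induces on R[x] a functional that is nonnegative on
   [QM1 S1], and hence, by the same theorem, on polynomials that are nonnegative on
   the compact set [K = KS1 S1].

   Its representing measure is built without the Riesz theorem.  The functional
   extends, by Zorn's lemma, to a positive functional [Lam] on all bounded functions on
   [K], that is to a finitely additive probability on all subsets.  Cutting [K] by
   countably many half-spaces and cutting [0, 1[ accordingly into intervals with the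
   same weights couples a uniform variable with nested cells of [K] whose
   diameters tend to 0; the law of the limit point is the required measure. *)
Require Import Defs.
From HB Require Import structures.
From mathcomp Require Import all_boot all_order all_algebra.
From mathcomp Require Import finmap.
From mathcomp Require Import monalg.
From mathcomp Require Import all_classical all_reals all_analysis measurable_realfun.
From mathcomp Require Import ring lra.
Set Implicit Arguments.
Unset Strict Implicit.
Unset Printing Implicit Defensive.
Import Order.TTheory GRing.Theory Num.Theory.
Import numFieldNormedType.Exports.
Local Open Scope classical_set_scope.
Local Open Scope ring_scope.

(** * Archimedean Positivstellensatz *)

Section Cones.
Variables (V : zmodType) (u : V) (ops : set (V -> V)).

(** [ops] stays abstract so that one Zorn argument serves twice: with multiplication by squares in a
    ring and with nonnegative scaling of functions. *)
Definition is_cone (C : set V) : Prop :=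
  [/\ C u, (forall x y, C x -> C y -> C (x + y))
     & (forall o x, ops o -> C x -> C (o x))].

Lemma maximal_cone (C : set V) : is_cone C -> ~ C (- u) ->
  exists Q : set V, [/\ C `<=` Q, is_cone Q, ~ Q (- u)
    & forall Q', Q `<=` Q' -> is_cone Q' -> ~ Q' (- u) -> Q' `<=` Q].
Proof.
move=> coneC Cu.
(* The condition is put on the union with [C] and not on [X] itself, so that the empty chain, whose
   union is empty, satisfies it. *)
pose P := [set X : set V | is_cone (C `|` X) /\ ~ (C `|` X) (- u)].
have [F FP Ftot|A [[PA PAu] Amax]] := @Zorn_bigcup V P.
  have [C1 C2 C3] := coneC; split; last first.
    by case=> // -[X /FP[_ +] Xu]; apply; right.
  split; first by left.
    move=> x y [Cx|[X FX Xx]] [Cy|[Y FY Yy]].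
    - by left; apply: C2.
    - have [[_ /(_ x y) + _] _] := FP _ FY.
      by case; [left|right|left|by right; exists Y].
    - have [[_ /(_ x y) + _] _] := FP _ FX.
      by case; [right|left|left|by right; exists X].
    - have [XY|YX] := Ftot _ _ FX FY.
        have [[_ /(_ x y) + _] _] := FP _ FY.
        by case; [right; apply: XY|right|left|by right; exists Y].
      have [[_ /(_ x y) + _] _] := FP _ FX.
      by case; [right|right; apply: YX|left|by right; exists X].
  move=> o x oo [Cx|[X FX Xx]]; first by left; apply: C3.
  have [[_ _ /(_ o x oo (or_intror Xx)) +] _] := FP _ FX.
  by case; [left|right; exists X].
exists (C `|` A); split => //.
move=> Q' AQ' coneQ' Qu' x Qx; apply: contrapT => nx.
apply: (Amax Q').
  split; first by move=> y Ay; apply: AQ'; right.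
  by move=> Q'A; apply: nx; right; apply: Q'A.
suff CQ' : C `|` Q' = Q' by split; rewrite CQ'.
by apply/seteqP; split=> y; [case=> // Cy; apply: AQ'; left|right].
Qed.

End Cones.

(** * The real functional cut out by a total cone *)

Section TotalCone.
Variables (R : realType) (V : lmodType R) (u : V) (Q : set V).
Hypotheses (Qu : Q u) (QD : forall x y, Q x -> Q y -> Q (x + y)).
Hypothesis QZ : forall c x, 0 <= c -> Q x -> Q (c *: x).
Hypotheses (Qproper : ~ Q (- u)) (Qtot : forall x, Q x \/ Q (- x)).

Definition cone_bounded (x : V) := exists r : R, Q (r *: u - x) /\ Q (r *: u + x).

(** A Dedekind cut along the line spanned by [u]; it is meaningful for [cone_bounded] elements, and
    the supremum may be a default value elsewhere. *)
Definition cone_functional (x : V) : R := sup [set r | Q (x - r *: u)].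

Local Notation phi := cone_functional.

(** If [r < s], scaling by [(s - r)^-1] would put [- u] into [Q]. *)
Let Q_lt r s : Q (r *: u - s *: u) -> s <= r.
Proof.
rewrite -scalerBl => Qrs; rewrite leNgt; apply/negP => lt_rs; apply: Qproper.
have := QZ (c := (s - r)^-1) _ Qrs; rewrite invr_ge0 subr_ge0 ltW// scalerA.
rewrite -[r - s]opprB mulrN mulVf ?scaleN1r; last by rewrite subr_eq0 gt_eqF.
exact.
Qed.

Let Qle r s x : s <= r -> Q (x - r *: u) -> Q (x - s *: u).
Proof.
move=> sr Qx; have -> : x - s *: u = (x - r *: u) + (r - s) *: u.
  by rewrite scalerBl addrA subrK.
by apply: QD => //; apply: QZ => //; rewrite subr_ge0.
Qed.

(** The first bound is strict because [Q] need not be closed: [x - phi x *: u] itself may lie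
    outside it. *)
Lemma cone_functionalP x : cone_bounded x ->
  (forall r, r < phi x -> Q (x - r *: u)) /\
  (forall r, Q (x - r *: u) -> r <= phi x).
Proof.
move=> [N [QN1 QN2]].
have sx : has_sup [set r | Q (x - r *: u)].
  split; first by exists (- N); rewrite /= scaleNr opprK addrC.
  exists N => r /= Qr; apply: Q_lt.
  by rewrite -(subrK x (N *: u)) -addrA; apply: QD.
split=> r; last by move=> Qr; apply: ub_le_sup => //; case: sx.
move=> /(sup_gt (proj1 sx))[s /= Qs rs].
exact: Qle (ltW rs) Qs.
Qed.

Lemma cone_functional_gt x r : cone_bounded x -> phi x < r -> Q (r *: u - x).
Proof.
move=> /cone_functionalP[_ phiP] xr.
have [/phiP|] := Qtot (x - r *: u); first by rewrite leNgt xr.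
by rewrite opprB.
Qed.

(** The margins [e] avoid the undecided boundary of the cut. Additivity and positive homogeneity are
    derived through this criterion. *)
Lemma cone_functionalE x r : cone_bounded x ->
  (forall e, 0 < e -> Q ((r + e) *: u - x)) ->
  (forall e, 0 < e -> Q (x - (r - e) *: u)) -> phi x = r.
Proof.
move=> bx h1 h2; have [p1 p2] := cone_functionalP bx.
apply/eqP; rewrite eq_le; apply/andP; split; apply/ler_addgt0Pr => e e0.
  have e2 : 0 < e / 2 by rewrite divr_gt0.
  have /p1 Qx : phi x - e / 2 < phi x by rewrite gtrBl.
  have := Q_lt (r := r + e / 2) (s := phi x - e / 2).
  rewrite -(subrK x (_ *: u)) -addrA.
  move=> /(_ (QD (h1 _ e2) Qx)).
  by lra.
by rewrite -lerBlDr; apply: p2; exact: h2.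
Qed.

Lemma cone_bounded_unit : cone_bounded u.
Proof.
exists 1; rewrite scale1r subrr; split; last exact: QD.
by rewrite -(scale0r u); apply: QZ.
Qed.

Lemma cone_boundedD x y : cone_bounded x -> cone_bounded y -> cone_bounded (x + y).
Proof.
move=> [r [r1 r2]] [s [s1 s2]]; exists (r + s); rewrite scalerDl.
by split; rewrite ?opprD addrACA; apply: QD.
Qed.

Lemma cone_boundedZ c x : cone_bounded x -> cone_bounded (c *: x).
Proof.
move=> [r [r1 r2]]; exists (`|c| * r); rewrite -scalerA.
have [c0|c0] := leP 0 c.
  by rewrite ger0_norm// -scalerBr -scalerDr; split; apply: QZ.
rewrite ltr0_norm// -(opprK (c *: x)) -scaleNr opprK -scalerBr -scalerDr.
by split; apply: QZ => //; rewrite oppr_ge0 ltW.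
Qed.

Lemma cone_functional_unit : phi u = 1.
Proof.
apply: cone_functionalE; first exact: cone_bounded_unit.
  by move=> e e0; rewrite scalerDl scale1r addrAC subrr add0r; apply: QZ => //; apply: ltW.
move=> e e0; rewrite scalerBl scale1r opprB addrC subrK; apply: QZ => //; exact: ltW.
Qed.

Lemma cone_functionalD x y : cone_bounded x -> cone_bounded y ->
  phi (x + y) = phi x + phi y.
Proof.
move=> bx bY; apply: cone_functionalE; first exact: cone_boundedD.
  move=> e e0; rewrite [e]splitr addrACA scalerDl opprD addrACA.
  by apply: QD; apply: cone_functional_gt => //; rewrite ltrDl divr_gt0.
move=> e e0; rewrite [e]splitr opprD addrACA scalerDl opprD addrACA.
by apply: QD; [have [+ _] := cone_functionalP bx|have [+ _] := cone_functionalP bY];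
  apply; rewrite gtrBl divr_gt0.
Qed.

Lemma cone_functional_ge0 x : cone_bounded x -> Q x -> 0 <= phi x.
Proof.
by move=> /cone_functionalP[_ +] Qx; apply; rewrite scale0r subr0.
Qed.

Lemma cone_functional_gt0 x : cone_bounded x -> 0 < phi x -> Q x.
Proof.
by move=> /cone_functionalP[+ _] x0 => /(_ _ x0); rewrite scale0r subr0.
Qed.

Lemma cone_functionalN x : cone_bounded x -> phi (- x) = - phi x.
Proof.
move=> bx; have bNx : cone_bounded (- x) by rewrite -scaleN1r; apply: cone_boundedZ.
apply/eqP; rewrite -addr_eq0 addrC -cone_functionalD// subrr; apply/eqP.
have b0 : cone_bounded 0 by rewrite -(scale0r x); apply: cone_boundedZ.
by apply: (addrI (phi 0)); rewrite -cone_functionalD// !addr0.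
Qed.

Lemma cone_functionalZ c x : cone_bounded x -> phi (c *: x) = c * phi x.
Proof.
wlog c0 : c / 0 <= c.
  move=> H bx; have [|c0] := leP 0 c; first by move=> /H; exact.
  rewrite -(opprK (c *: x)) -scaleNr cone_functionalN ?H ?oppr_ge0 1?ltW//.
    by rewrite mulNr opprK.
  exact: cone_boundedZ.
move=> bx; move: c0; rewrite le_eqVlt => /orP[/eqP <-|c0].
  rewrite scale0r mul0r -(subrr x) -scaleN1r cone_functionalD//; last exact: cone_boundedZ.
  by rewrite scaleN1r cone_functionalN// subrr.
apply: cone_functionalE; first exact: cone_boundedZ.
  move=> e e0; have -> : c * phi x + e = c * (phi x + e / c).
    by rewrite mulrDr mulrCA mulfV ?gt_eqF// mulr1.
  rewrite -scalerA -scalerBr; apply: QZ; first exact: ltW.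
  by apply: cone_functional_gt => //; rewrite ltrDl divr_gt0.
move=> e e0; have -> : c * phi x - e = c * (phi x - e / c).
  by rewrite mulrBr mulrCA mulfV ?gt_eqF// mulr1.
rewrite -scalerA -scalerBr; apply: QZ; first exact: ltW.
by have [+ _] := cone_functionalP bx; apply; rewrite gtrBl divr_gt0.
Qed.

End TotalCone.

(** * Quadratic modules in commutative algebras over the reals *)

Section QuadraticModules.
Variables (R : realType) (A : comAlgType R) (M : set A).
Hypothesis qmM : is_qmodule M.

Lemma qm1 : M 1. Proof. by case: qmM. Qed.

Lemma qmD x y : M x -> M y -> M (x + y). Proof. by case: qmM => _ + _; apply. Qed.

Lemma qmM2 a x : M x -> M (a ^+ 2 * x). Proof. by case: qmM => _ _; apply. Qed.

Lemma qm_sqr a : M (a ^+ 2). Proof. by rewrite -[_ ^+ 2]mulr1; apply/qmM2/qm1. Qed.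

(** A nonnegative real is a square, so a quadratic module is a convex cone. *)
Lemma qmZ c x : 0 <= c -> M x -> M (c *: x).
Proof.
move=> c0 Mx; have -> : c *: x = (Num.sqrt c)%:A ^+ 2 * x; last exact: qmM2.
by rewrite exprZn expr1n sqr_sqrtr// mulr_algl.
Qed.

Lemma qm_nat n : M n%:R.
Proof.
by rewrite -scaler_nat; apply: qmZ => //; exact: qm1.
Qed.

Lemma qmMn n x : M x -> M (n%:R * x).
Proof. by move=> Mx; rewrite mulr_natl -scaler_nat; exact: qmZ. Qed.

Lemma qm_div n x : (0 < n)%N -> M (n%:R * x) -> M x.
Proof.
move=> n0; rewrite mulr_natl -scaler_nat => /(qmZ (c := n%:R^-1)).
by rewrite scalerA mulVf ?scale1r ?pnatr_eq0 -?lt0n// invr_ge0; apply.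
Qed.

(* Marshall's argument: with [N] bounding [s] and [s ^+ 2 * a], an upper bound
   [N * a + k] in [M] improves to [N * a + k.-1], by the identity
   [N^2 (N a + k - 1) = (N - s)^2 (N a + k) + 2 N^2 (s a - 1)
                          + N (N - s^2 a) + k s (2 N - s)]. *)
Lemma qm_cancel s a : qm_archimedean M -> M s -> M (s * a - 1) -> M a.
Proof.
move=> arch Ms Msa.
have [K [_ MK]] := arch s; have [L [_ ML]] := arch (s ^+ 2 * a).
pose N := (K + L).+1.
have NE : N%:R = K%:R + L%:R + 1 :> A by rewrite /N -addn1 !natrD.
have MNs : M (N%:R - s).
  rewrite NE (_ : _ - _ = (K%:R - s) + (L.+1)%:R); last by rewrite -natr1; ring.
  by apply: qmD => //; exact: qm_nat.
have MNa : M (N%:R - s ^+ 2 * a).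
  rewrite NE (_ : _ - _ = (L%:R - s ^+ 2 * a) + (K.+1)%:R); last by rewrite -natr1; ring.
  by apply: qmD => //; exact: qm_nat.
have MsN : M (s * (N%:R - s)).
  apply: (@qm_div N) => //.
  rewrite (_ : _ * _ = s ^+ 2 * (N%:R - s) + (N%:R - s) ^+ 2 * s); last by ring.
  by apply: qmD; exact: qmM2.
have Ms2N : M (s * (2 * N%:R - s)).
  rewrite (_ : _ * _ = s * (N%:R - s) + N%:R * s); last by ring.
  by apply: qmD => //; exact: qmMn.
have descent k : M (N%:R * a + k.+1%:R) -> M (N%:R * a + k%:R).
  move=> Mk; apply: (@qm_div N) => //; apply: (@qm_div N) => //.
  rewrite (_ : _ * _ = (N%:R - s) ^+ 2 * (N%:R * a + k.+1%:R)
    + 2%:R * (N%:R * (N%:R * (s * a - 1)))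
    + N%:R * (N%:R - s ^+ 2 * a) + k.+1%:R * (s * (2 * N%:R - s))); last first.
    by rewrite -natr1; ring.
  do ![apply: qmD]; do ?exact: qmMn; [exact: qmM2|].
  by do 2!apply: qmMn; exact: qmMn.
(* Archimedeanity supplies a first [k]; the descent to [0] leaves [N * a], from which [N] is divided
   out. *)
have [k [Mk _]] := arch (N%:R * a).
move: Mk; rewrite addrC; elim: k => [|k IH]; last by move=> /descent.
by rewrite addr0; exact: qm_div.
Qed.

Lemma qm0 : M 0.
Proof. by rewrite -(mul0r 1) -[0](expr0n A 2); apply/qmM2/qm1. Qed.

(** The multiplier [s] ranges over all of [M], not only over sums of squares; [qm_cancel] is strong
    enough to handle such multipliers. *)
Lemma qm_adjoin a :
  is_qmodule [set x | exists m s, [/\ M m, M s & x = m + s * a]].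
Proof.
split.
- by exists 1, 0; split; [exact: qm1|exact: qm0|rewrite mul0r addr0].
- move=> _ _ [m [s [Mm Ms ->]]] [m' [s' [Mm' Ms' ->]]].
  by exists (m + m'), (s + s'); split; [exact: qmD|exact: qmD|ring].
- move=> b _ [m [s [Mm Ms ->]]].
  by exists (b ^+ 2 * m), (b ^+ 2 * s); split; [exact: qmM2|exact: qmM2|ring].
Qed.

End QuadraticModules.

(** * Characters nonnegative on a proper archimedean quadratic module *)

Section Characters.
Variables (R : realType) (A : comAlgType R) (M : set A).
Hypotheses (qmM : is_qmodule M) (archM : qm_archimedean M).

(** If adjoining [x] to the maximal [Q] gives [-1 = m + s * x], then [s * (- x) - 1 = m] lies in [Q]
    and [qm_cancel] yields [- x]. Otherwise maximality yields [x]. *)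
Lemma maximal_qmodule : ~ M (-1) -> exists Q : set A, [/\ M `<=` Q, is_qmodule Q,
  ~ Q (-1) & forall x, Q x \/ Q (- x)].
Proof.
move=> M1; pose ops := [set o : A -> A | exists a, o = fun x => a ^+ 2 * x].
have qmcone C : is_qmodule C <-> is_cone 1 ops C.
  split=> -[C1 CD CM]; split=> //; first by move=> _ x [a ->]; exact: CM.
  by move=> a x; apply: (CM (fun x => a ^+ 2 * x)); exists a.
have [Q [MQ /qmcone qmQ Q1 Qmax]] := maximal_cone ((qmcone M).1 qmM) M1.
exists Q; split=> // x.
have archQ : qm_archimedean Q.
  by move=> a; have [N [? ?]] := archM a; exists N; split; apply: MQ.
have [[m [s [Qm Qs E]]]|nQ'] := pselect
    ([set x' | exists m s, [/\ Q m, Q s & x' = m + s * x]] (-1)).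
  right; apply: (qm_cancel qmQ archQ Qs).
  by rewrite mulrN -opprD addrC [X in - X]addrC (_ : - _ = m)// -[m](addrK (s * x)) -E; ring.
left; apply: (Qmax _ _ ((qmcone _).1 (qm_adjoin qmQ x)) nQ').
- by move=> y Qy; exists y, 0; split; [|exact: qm0|rewrite mul0r addr0].
- by exists 0, 1; split; [exact: qm0|exact: qm1|rewrite mul1r add0r].
Qed.

Lemma proper_qm_character : ~ M (-1) ->
  exists phi : {rmorphism A -> R}, [/\ forall c, phi c%:A = c
    & forall x, M x -> 0 <= phi x].
Proof.
move=> /maximal_qmodule[Q [MQ qmQ Q1 Qtot]].
have bdd x : cone_bounded 1 Q x.
  have [N [N1 N2]] := archM x; exists N%:R.
  by rewrite scaler_nat; split; apply: MQ.
have Qu := qm1 qmQ; have QD := qmD qmQ; have QZ := qmZ qmQ.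
pose phi := cone_functional 1 Q.
have phiD x y : phi (x + y) = phi x + phi y by exact: cone_functionalD.
have phiN x : phi (- x) = - phi x by exact: cone_functionalN.
have phiZ c x : phi (c *: x) = c * phi x by exact: cone_functionalZ.
have phi1 : phi 1 = 1 by exact: cone_functional_unit.
have phi_ge0 x : Q x -> 0 <= phi x by exact: cone_functional_ge0.
have phi_gt0 x : 0 < phi x -> Q x by exact: cone_functional_gt0.
have phi_sqr0 a : phi a = 0 -> phi (a ^+ 2) = 0.
  move=> a0; apply/eqP; rewrite eq_le phi_ge0 ?andbT; last exact: qm_sqr.
  apply/ler_addgt0Pr => e e0; rewrite add0r.
  (* Since [phi a = 0], both [d - a] and [d + a] lie in [Q]. Combining them with square weights puts
     [2 d (d^2 - a^2)] in [Q], hence [phi (a ^+ 2) <= d^2 = e]. *)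
  pose d := Num.sqrt e; have d0 : 0 < d by rewrite sqrtr_gt0.
  have Q1a : Q (d%:A - a) by apply: phi_gt0; rewrite phiD phiN phiZ phi1 a0 mulr1 subr0.
  have Q2a : Q (d%:A + a) by apply: phi_gt0; rewrite phiD phiZ phi1 a0 mulr1 addr0.
  have : Q ((2 * d) *: ((d ^+ 2)%:A - a ^+ 2)).
    have -> : (2 * d) *: ((d ^+ 2)%:A - a ^+ 2) =
        (d%:A - a) ^+ 2 * (d%:A + a) + (d%:A + a) ^+ 2 * (d%:A - a).
      rewrite -[LHS]mulr_algl; have -> : (2 * d)%:A = 2%:R * d%:A :> A.
        by rewrite -scalerA scaler_nat mulr_natl.
      have -> : (d ^+ 2)%:A = d%:A ^+ 2 :> A by rewrite exprZn expr1n.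
      by ring.
    by apply: QD; exact: qmM2.
  move=> /phi_ge0; rewrite phiZ pmulr_rge0 ?mulr_gt0//.
  have -> : d ^+ 2 = e by rewrite sqr_sqrtr// ltW.
  by rewrite phiD phiN phiZ phi1 mulr1; lra.
(* Cauchy-Schwarz for the positive form [(a, b) |-> phi (a * b)] *)
have phi_mul0 a b : phi a = 0 -> phi (a * b) = 0.
  move=> a0; set p := phi (a * b).
  have H t : 0 <= phi (b ^+ 2) + 2 * t * p.
    have /phi_ge0 : Q ((b + t *: a) ^+ 2) by exact: qm_sqr.
    have -> : (b + t *: a) ^+ 2 = b ^+ 2 + ((2 * t) *: (a * b) + (t ^+ 2) *: a ^+ 2).
      rewrite sqrrD exprZn [RHS]addrA; congr (_ + _ + _).
      by rewrite -scalerAr [b * a]mulrC -scalerA scaler_nat.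
    by rewrite !phiD !phiZ (phi_sqr0 a)// mulr0 addr0.
  apply/eqP; apply: contraT => p0.
  (* This [t] makes the affine expression in [H] equal to [-1]. *)
  have := H (- (phi (b ^+ 2) + 1) / (2 * p)).
  have -> : 2 * (- (phi (b ^+ 2) + 1) / (2 * p)) * p = - (phi (b ^+ 2) + 1) by field.
  by lra.
have phiM : {morph phi : x y / x * y}.
  (* The kernel absorbs products by [phi_mul0], so it suffices to subtract from [x] its value. *)
  move=> x y; have : phi (x - (phi x)%:A) = 0 by rewrite phiD phiN phiZ phi1 mulr1 subrr.
  move=> /(phi_mul0 _ y); rewrite mulrBl phiD phiN mulr_algl phiZ.
  by move=> /eqP; rewrite subr_eq0 => /eqP.
have phiB : zmod_morphism phi by move=> x y; rewrite phiD phiN.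
pose F : {rmorphism A -> R} := HB.pack phi
  (GRing.isZmodMorphism.Build _ _ phi phiB)
  (GRing.isMonoidMorphism.Build _ _ phi (phi1, phiM)).
exists F; split=> [c|x Mx]; first by rewrite /= phiZ phi1 mulr1.
by apply: phi_ge0; exact: MQ.
Qed.

End Characters.

(** If [-1 = m - s (f + e)] with [m] and [s] in [M], then [s (f + e) - 1 = m] and [qm_cancel] puts
    [f + e] in [M]. So otherwise the enlarged module is proper, and its character has
    [phi f <= - e]. *)
Theorem archimedean_positivstellensatz (R : realType) (A : comAlgType R)
    (M : set A) (f : A) : is_qmodule M -> qm_archimedean M ->
  (forall phi : {rmorphism A -> R}, (forall c, phi c%:A = c) ->
     (forall x, M x -> 0 <= phi x) -> 0 <= phi f) ->
  forall e : R, 0 < e -> M (f + e%:A).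
Proof.
move=> qmM archM fpos e e0; apply: contrapT => nMf.
pose M' := [set x | exists m s, [/\ M m, M s & x = m + s * - (f + e%:A)]].
have qmM' : is_qmodule M' by exact: qm_adjoin.
have MM' : M `<=` M'.
  by move=> y My; exists y, 0; split; [|exact: qm0|rewrite mul0r addr0].
have M'1 : ~ M' (-1).
  move=> [m [s [Mm Ms E]]]; apply: nMf; apply: (qm_cancel qmM archM Ms).
  suff -> : s * (f + e%:A) - 1 = m by [].
  by rewrite E; ring.
have archM' : qm_archimedean M'.
  by move=> a; have [N [? ?]] := archM a; exists N; split; apply: MM'.
have [phi [phiC phi_ge0]] := proper_qm_character qmM' archM' M'1.
have /phi_ge0 : M' (- (f + e%:A)).
  by exists 0, 1; split; [exact: qm0|exact: qm1|rewrite mul1r add0r].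
rewrite rmorphN rmorphD/= phiC oppr_ge0 leNgt ltr_wpDl// fpos// => x Mx.
by apply: phi_ge0; exact: MM'.
Qed.

(** * Polynomial rings *)

Section PolynomialRing.
Variables (R : comNzRingType) (I : choiceType).

(** Induction on the total degree: a variable of the support is divided out. *)
Lemma cmonom_ind (P : cmonom I -> Prop) : P (onecm I) ->
  (forall i k, P k -> P (mulcm (ucm i) k)) -> forall k, P k.
Proof.
move=> P1 PM k; move dk : (mdeg k) => d; elim: d k dk => [|d IH] k dk.
  by move/eqP: dk; rewrite mdeg_eq0 => /eqP ->.
have [i ki] : exists i, i \in finsupp (cmonom_val k).
  have [E|//] := fset_0Vmem (finsupp (cmonom_val k)); last by case=> i ?; exists i.
  by move: dk; rewrite mdegE E big_seq_fset0.
have E : k = mulcm (ucm i) (divcm k (ucm i)).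
  apply/eqP/cmP => j; rewrite mulcmE divcmE ucmE.
  have [<-|_] := eqVneq i j; last by rewrite subn0.
  by rewrite subnKC// lt0n cmE_neq0.
rewrite E; apply: PM; apply: IH.
by move: dk; rewrite [in mdeg k]E (mdegM (ucm i)) mdegU => -[].
Qed.

Lemma mkmalgU_scale (c : R) (k : cmonom I) : mkmalgU k c = c *: mkmalgU k 1 :> polyring R I.
Proof. rewrite -mul_malgC malgM_def.
rewrite fgmulUU.
by rewrite mulr1 mul1m. Qed.

Lemma mkmalgUM (k l : cmonom I) :
  mkmalgU (mulcm k l) 1 = mkmalgU k 1 * mkmalgU l 1 :> polyring R I.
Proof. by rewrite malgM_def fgmulUU mulr1. Qed.

Lemma pconstE (c : R) : pconst I c = c%:A.
Proof. exact: mkmalgU_scale. Qed.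

Lemma polyring_ind (P : polyring R I -> Prop) :
  (forall c, P c%:A) -> (forall i, P (pvar R i)) ->
  (forall p q, P p -> P q -> P (p + q)) -> (forall p q, P p -> P q -> P (p * q)) ->
  forall p, P p.
Proof.
move=> PC PX PD PM p; rewrite (monalgE p).
have P0 : P 0 by rewrite -(scale0r 1); exact: PC.
apply: (big_ind P P0 PD) => k _.
rewrite mkmalgU_scale -mulr_algl; apply: (PM _ _ (PC _)).
elim/cmonom_ind: k => [|i k IH]; last first.
  by rewrite (mkmalgUM (ucm i) k); exact: (PM _ _ (PX i) IH).
by have := PC 1; rewrite scale1r.
Qed.

(** This identifies an abstract character with evaluation at the images of the variables. *)
Lemma polyring_morph_ext (S : nzRingType) (f g : {rmorphism polyring R I -> S}) :
  (forall c, f c%:A = g c%:A) -> (forall i, f (pvar R i) = g (pvar R i)) -> f =1 g.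
Proof.
move=> fgC fgX; elim/polyring_ind => // p q fp fq; first by rewrite !rmorphD fp fq.
by rewrite !rmorphM fp fq.
Qed.

Lemma pconst_zmod_morphism : zmod_morphism (@pconst R I).
Proof. by move=> x y; rewrite !pconstE scalerBl. Qed.

Lemma pconst_monoid_morphism : monoid_morphism (@pconst R I).
Proof.
split=> [|x y]; first by rewrite pconstE scale1r.
by rewrite !pconstE -scalerAl mul1r scalerA.
Qed.

End PolynomialRing.

HB.instance Definition _ (R : comNzRingType) (I : choiceType) :=
  GRing.isZmodMorphism.Build R (polyring R I) (@pconst R I) (@pconst_zmod_morphism R I).
HB.instance Definition _ (R : comNzRingType) (I : choiceType) :=
  GRing.isMonoidMorphism.Build R (polyring R I) (@pconst R I) (@pconst_monoid_morphism R I).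

Section Monval.
Variables (S : comNzRingType) (I : choiceType) (v : I -> S).

(** Variables outside the support contribute a factor [1]; monomials with different supports thus
    become products over one common set. *)
Lemma monvalEw (d : {fset I}) (k : cmonom I) : (finsupp (cmonom_val k) `<=` d)%fset ->
  monval v k = \prod_(i <- d) v i ^+ cmonom_val k i.
Proof.
move=> kd; rewrite /monval; apply/esym.
rewrite (big_fsetID _ (mem (finsupp (cmonom_val k))))/=.
rewrite [X in _ * X]big1_fset ?mulr1; last first.
  by move=> i; rewrite !inE/= => /andP[_ /fsfun_dflt ->].
apply: eq_fbigl => i; rewrite !inE/=.
by apply/andP/idP => [[]//|ik]; split=> //; exact: (fsubsetP kd).
Qed.

Lemma monval1 : monval v (onecm I) = 1.
Proof. by rewrite /monval (mdom1 : finsupp (cmonom_val (onecm I)) = _) big_seq_fset0. Qed.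

Lemma monvalM k l : monval v (mulcm k l) = monval v k * monval v l.
Proof.
set d := (finsupp (cmonom_val k) `|` finsupp (cmonom_val l))%fset.
rewrite (@monvalEw d k) ?fsubsetUl// (@monvalEw d l) ?fsubsetUr//.
rewrite (@monvalEw d) ?mdomD// -big_split/=.
by apply: eq_bigr => i _; rewrite -exprD; congr (_ ^+ _); exact: mulcmE.
Qed.

Lemma monvalU i : monval v (ucm i) = v i.
Proof. by rewrite /monval (mdomU i) big_seq_fset1 (cmUU i) expr1. Qed.

End Monval.

HB.instance Definition _ (S : comNzRingType) (I : choiceType) (v : I -> S) :=
  isMultiplicative.Build (cmonom I) S (monval v) (monvalM v, monval1 v).

Lemma monval_fin (S : comNzRingType) (I : finType) (v : I -> S) (k : cmonom I) :
  monval v k = \prod_i v i ^+ cmonom_val k i.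
Proof.
elim/cmonom_ind: k => [|i k IH].
  by rewrite monval1 big1// => i _; rewrite onecmE.
rewrite monvalM monvalU IH [RHS](eq_bigr (fun j => v j ^+ (i == j) * v j ^+ cmonom_val k j)).
  rewrite big_split/=; congr (_ * _).
  rewrite (bigD1 i)//= eqxx big1 ?mulr1// => j.
  by rewrite eq_sym => /negPf ->.
by move=> j _; rewrite -exprD; congr (_ ^+ _); rewrite -ucmE; exact: mulcmE.
Qed.

Lemma cmonom_fin (I : finType) (a : I -> nat) :
  exists k : cmonom I, forall i, cmonom_val k i = a i.
Proof.
exists [cmonom a i | i in [fset i | i in I]%fset]%M => i.
by rewrite cmE fsfunE !inE.
Qed.

Section Evaluation.
Variables (R : comNzRingType) (I : choiceType).

Variable (v : I -> R).

Lemma peval_zmod_morphism : zmod_morphism (peval v).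
Proof. by move=> x y; rewrite /peval raddfB. Qed.

Lemma peval_monoid_morphism : monoid_morphism (peval v).
Proof. by split=> [|x y]; rewrite /peval ?rmorph1 ?rmorphM. Qed.

Lemma peval_const c : peval v (pconst I c) = c.
Proof. by rewrite /peval /pconst mmapU monval1 mulr1. Qed.

Lemma peval_var i : peval v (pvar R i) = v i.
Proof. by rewrite /peval /pvar mmapU monvalU mul1r. Qed.

Lemma pevalU c k : peval v (mkmalgU k c) = c * monval v k.
Proof. by rewrite /peval mmapU. Qed.

Variables (J : choiceType) (w : I -> polyring R J).

Lemma psubst_zmod_morphism : zmod_morphism (psubst w).
Proof. by move=> x y; rewrite /psubst raddfB. Qed.

Lemma psubst_monoid_morphism : monoid_morphism (psubst w).
Proof. by split=> [|x y]; rewrite /psubst ?rmorph1 ?rmorphM. Qed.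

Lemma psubst_const c : psubst w (pconst I c) = pconst J c.
Proof. by rewrite /psubst {1}/pconst mmapU monval1 mulr1. Qed.

Lemma psubst_var i : psubst w (pvar R i) = w i.
Proof. by rewrite /psubst /pvar mmapU monvalU/= pconstE scale1r mul1r. Qed.

Lemma psubstU k : psubst w (mkmalgU k 1) = monval w k.
Proof. by rewrite /psubst mmapU/= pconstE scale1r mul1r. Qed.

End Evaluation.

HB.instance Definition _ (R : comNzRingType) (I : choiceType) (v : I -> R) :=
  GRing.isZmodMorphism.Build (polyring R I) R (peval v) (peval_zmod_morphism v).
HB.instance Definition _ (R : comNzRingType) (I : choiceType) (v : I -> R) :=
  GRing.isMonoidMorphism.Build (polyring R I) R (peval v) (peval_monoid_morphism v).
HB.instance Definition _ (R : comNzRingType) (I J : choiceType) (w : I -> polyring R J) :=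
  GRing.isZmodMorphism.Build (polyring R I) (polyring R J) (psubst w)
    (psubst_zmod_morphism w).
HB.instance Definition _ (R : comNzRingType) (I J : choiceType) (w : I -> polyring R J) :=
  GRing.isMonoidMorphism.Build (polyring R I) (polyring R J) (psubst w)
    (psubst_monoid_morphism w).

(** * Archimedeanity of a quadratic module, tested on the variables *)

Section ArchimedeanPolynomials.
Variables (R : realType).

(** Rounding a real bound up to a natural one makes the closure lemmas for [cone_bounded] available
    for archimedeanity. *)
Lemma cone_bounded1P (A : comAlgType R) (M : set A) : is_qmodule M -> forall a : A,
  cone_bounded 1 M a <-> exists N : nat, M (N%:R + a) /\ M (N%:R - a).
Proof.
move=> qmM a; split=> [[r [r1 r2]]|[N [N1 N2]]]; last by exists N%:R; rewrite scaler_nat.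
exists (Num.bound `|r|).
have H : M ((Num.bound `|r|)%:R - r%:A).
  rewrite -scaler_nat -scalerBl; apply: qmZ => //; last exact: qm1.
  by rewrite subr_ge0 ltW// (le_lt_trans (ler_norm r))// archi_boundP.
by split; [rewrite -(subrK r%:A _%:R) -addrA|rewrite -(subrK r%:A _%:R) -addrA];
  apply: qmD.
Qed.

(** Squares come first, from [2K (K^2 - c^2) = (K - c)^2 (K + c) + (K + c)^2 (K - c)]. Products
    follow by polarization. *)
Lemma cone_bounded1M (A : comAlgType R) (M : set A) (a b : A) : is_qmodule M ->
  cone_bounded 1 M a -> cone_bounded 1 M b -> cone_bounded 1 M (a * b).
Proof.
move=> qmM.
have bD x y : cone_bounded 1 M x -> cone_bounded 1 M y -> cone_bounded 1 M (x + y).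
  by apply: cone_boundedD; exact: qmD.
have bZ c x : cone_bounded 1 M x -> cone_bounded 1 M (c *: x).
  by apply: cone_boundedZ => *; exact: qmZ.
have bsqr c : cone_bounded 1 M c -> cone_bounded 1 M (c ^+ 2).
  move=> /(cone_bounded1P qmM)[N [N1 N2]]; apply/(cone_bounded1P qmM).
  (* The bound [N] may be [0], while [2 * K] has to be divided out. *)
  pose K := N.+1.
  have K1 : M (K%:R + c).
    by rewrite -natr1 addrAC; apply: qmD => //; exact: qm1.
  have K2 : M (K%:R - c).
    by rewrite -natr1 addrAC; apply: qmD => //; exact: qm1.
  exists (K ^ 2)%N; split; first by apply: qmD; [|exact: qm_nat|exact: qm_sqr].
  apply: (@qm_div _ _ _ qmM (2 * K)) => //.
  rewrite natrX natrM (_ : _ * _ = (K%:R - c) ^+ 2 * (K%:R + c) +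
    (K%:R + c) ^+ 2 * (K%:R - c)); last by ring.
  by apply: qmD => //; exact: qmM2.
move=> ba bb.
have -> : a * b = (4^-1) *: ((a + b) ^+ 2 + (-1) *: (a + (-1) *: b) ^+ 2).
  have -> : (a + b) ^+ 2 + (-1) *: (a + (-1) *: b) ^+ 2 = (4 : R) *: (a * b).
    by rewrite !scaleN1r scaler_nat; ring.
  by rewrite scalerA mulVf ?scale1r.
exact: (bZ _ _ (bD _ _ (bsqr _ (bD _ _ ba bb)) (bZ _ _ (bsqr _ (bD _ _ ba (bZ _ _ bb)))))).
Qed.

Lemma archimedean_polyring (I : choiceType) (M : set (polyring R I)) :
  is_qmodule M ->
  (forall i, exists N : nat, M (N%:R + pvar R i) /\ M (N%:R - pvar R i)) ->
  qm_archimedean M.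
Proof.
move=> qmM Mvar p; apply/(cone_bounded1P qmM); elim/polyring_ind: p.
- move=> c; apply: cone_boundedZ; first by move=> *; exact: qmZ.
  apply/(cone_bounded1P qmM); exists 1%N; rewrite subrr; split; last exact: qm0.
  by apply: qmD => //; exact: qm1.
- by move=> i; apply/(cone_bounded1P qmM).
- by move=> p q; apply: cone_boundedD; exact: qmD.
- by move=> p q; exact: cone_bounded1M.
Qed.

End ArchimedeanPolynomials.

Section GeneratedQuadraticModule.
Variables (A : comNzRingType) (G : set A).

Lemma qmgen_qmodule : is_qmodule (qmgen G).
Proof.
split=> [M [M1 _ _]//|x y Gx Gy M qmM GM|a x Gx M qmM GM].
  by case: (qmM) => _ + _; apply; [apply: Gx|apply: Gy].
by case: (qmM) => _ _; apply; apply: Gx.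
Qed.

Lemma sub_qmgen : G `<=` qmgen G.
Proof. by move=> x Gx M _; apply. Qed.

(** Since [qmgen] is an intersection, a property holds on it once it defines a quadratic module
    containing the generators. Preimages under morphisms, notably of the nonnegative reals, supply
    such modules. *)
Lemma qmodule_preimage (B : comNzRingType) (f : {rmorphism B -> A}) (M : set A) :
  is_qmodule M -> is_qmodule (f @^-1` M).
Proof.
move=> [M1 MD MM]; split=> [|x y Mx My|a x Mx].
- by rewrite /preimage/= rmorph1.
- by rewrite /preimage/= rmorphD; exact: MD.
- by rewrite /preimage/= rmorphM rmorphXn; exact: MM.
Qed.

End GeneratedQuadraticModule.

Lemma nonneg_qmodule (R : realType) : is_qmodule [set r : R | 0 <= r].
Proof.
split=> [|x y|a x] /=; [exact: ler01|exact: addr_ge0|].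
by apply: mulr_ge0; exact: sqr_ge0.
Qed.

(** * Positive functionals and the quantile coupling *)

Section MeanExtension.
Variables (R : realType) (T : Type) (K : set T).

Definition bounded_on (g : T -> R) := exists M, forall x, K x -> `|g x| <= M.

(** A finitely additive probability on [K], seen as a normalized positive functional. [Lam] is
    total, but constrained only on functions bounded on [K]. *)
Definition is_mean (Lam : (T -> R) -> R) : Prop :=
  [/\ Lam (fun=> 1) = 1,
      (forall g h, bounded_on g -> bounded_on h ->
         Lam (fun x => g x + h x) = Lam g + Lam h),
      (forall c g, bounded_on g -> Lam (fun x => c * g x) = c * Lam g)
    & (forall g, bounded_on g -> (forall x, K x -> 0 <= g x) -> 0 <= Lam g)].

(** The functions that dominate on [K] some [ev w] with [0 <= L w] form a cone without [-1]. A
    maximal such cone is total, and its cut functional extends [L]. *)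
Lemma mean_extension (W : lmodType R) (ev : W -> T -> R) (L : W -> R) (w1 : W) :
  (forall v w x, ev (v + w) x = ev v x + ev w x) ->
  (forall c w x, ev (c *: w) x = c * ev w x) ->
  (forall v w, L (v + w) = L v + L w) -> (forall c w, L (c *: w) = c * L w) ->
  (forall x, ev w1 x = 1) -> L w1 = 1 ->
  (forall w, (forall x, K x -> 0 <= ev w x) -> 0 <= L w) ->
  (forall w, bounded_on (ev w)) ->
  exists2 Lam, is_mean Lam & forall w, Lam (ev w) = L w.
Proof.
move=> evD evZ LD LZ ev1 L1 Lpos evb.
pose u : T -> R := fun=> 1.
pose ops := [set o : (T -> R) -> (T -> R) | exists2 c, 0 <= c & o = fun g => c *: g].
pose C0 := [set g : T -> R | exists2 w, 0 <= L w & forall x, K x -> ev w x <= g x].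
have L0 : L 0 = 0 by rewrite -(scale0r w1) LZ mul0r.
have ev0 x : ev 0 x = 0 by rewrite -(scale0r w1) evZ mul0r.
have coneC0 : is_cone u ops C0.
  split.
  - by exists w1; [rewrite L1|move=> x _; rewrite ev1].
  - move=> g h [v v0 vg] [w w0 wh]; exists (v + w); first by rewrite LD addr_ge0.
    by move=> x Kx; rewrite evD; apply: lerD; [exact: vg|exact: wh].
  - move=> _ g [c c0 ->] [w w0 wg]; exists (c *: w); first by rewrite LZ mulr_ge0.
    by move=> x Kx; rewrite evZ; apply: ler_wpM2l => //; exact: wg.
have C0u : ~ C0 (- u).
  (* If [ev w <= -1] on [K], then [- (w + w1)] is nonnegative there, which forces [L w <= -1]. *)
  move=> [w w0 wu]; have : 0 <= L ((-1) *: (w + w1)).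
    apply: Lpos => x Kx; rewrite evZ evD ev1.
    have {}wu : ev w x <= -1 := wu x Kx.
    by lra.
  by rewrite LZ LD L1; lra.
have [Q [C0Q [Qu QD Qops] Qproper Qmax]] := maximal_cone coneC0 C0u.
have QZ (c : R) (g : T -> R) : 0 <= c -> Q g -> Q (c *: g).
  by move=> c0; apply: (Qops (fun g => c *: g)); exists c.
have Qpos (g : T -> R) : (forall x, K x -> 0 <= g x) -> Q g.
  by move=> gpos; apply: C0Q; exists 0; [rewrite L0|move=> x Kx; rewrite ev0 gpos].
have Qtot (g : T -> R) : Q g \/ Q (- g).
  pose Q' := [set h | exists q c, [/\ Q q, 0 <= c & h = q + c *: g]].
  have QQ' : Q `<=` Q' by move=> q Qq; exists q, 0; split; rewrite ?scale0r ?addr0.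
  have [[q [c [Qq c0 E]]]|nQ'] := pselect (Q' (- u)).
    right; move: c0; rewrite le_eqVlt => /orP[/eqP c0|c0].
      by exfalso; apply: Qproper; rewrite E -c0 scale0r addr0.
    have -> : - g = c^-1 *: (u + q).
      have -> : u + q = - (c *: g).
        by apply/eqP; rewrite -addr_eq0 -addrA -E subrr.
      by rewrite scalerN scalerA mulVf ?gt_eqF// scale1r.
    by apply: QZ; [rewrite invr_ge0 ltW|exact: QD].
  left; apply: (Qmax _ QQ' _ nQ'); last first.
    exists 0, 1; split; [|exact: ler01|by rewrite add0r scale1r].
    by apply: Qpos => x _; exact: lexx.
  split; first exact: QQ'.
  - move=> _ _ [q [c [Qq c0 ->]]] [q' [c' [Qq' c'0 ->]]].
    exists (q + q'), (c + c'); split; [exact: QD|exact: addr_ge0|].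
    by rewrite scalerDl addrACA.
  - move=> _ _ [d d0 ->] [q [c [Qq c0 ->]]].
    exists (d *: q), (d * c); split; [exact: QZ|exact: mulr_ge0|].
    by rewrite scalerDr scalerA.
have bdd (g : T -> R) : bounded_on g -> cone_bounded u Q g.
  have E1 M x : (M *: u - g) x = M * 1 - g x by [].
  have E2 M x : (M *: u + g) x = M * 1 + g x by [].
  move=> [M gM]; exists M; split; apply: Qpos => x /gM; rewrite ler_norml => /andP[].
    by rewrite E1; lra.
  by rewrite E2; lra.
exists (cone_functional u Q).
  split.
  - exact: cone_functional_unit.
  - by move=> g h /bdd bg /bdd bh; exact: cone_functionalD.
  - by move=> c g /bdd bg; exact: cone_functionalZ.
  - by move=> g /bdd bg /Qpos; exact: cone_functional_ge0.
move=> w; apply: cone_functionalE => //; first by apply: bdd; exact: evb.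
(* The witness is the function itself written in [W]; its value under [L] is [e]. *)
- move=> e e0; apply: C0Q; exists ((L w + e) *: w1 + (-1) *: w).
    by rewrite LD !LZ L1; lra.
  have E x : ((L w + e) *: u - ev w) x = (L w + e) * 1 - ev w x by [].
  by move=> x _; rewrite evD !evZ ev1 E; lra.
- move=> e e0; apply: C0Q; exists (w + (e - L w) *: w1).
    by rewrite LD !LZ L1; lra.
  have E x : (ev w - (L w - e) *: u) x = ev w x - (L w - e) * 1 by [].
  by move=> x _; rewrite evD !evZ ev1 E; lra.
Qed.

End MeanExtension.

Section MeanTheory.
Variables (R : realType) (T : Type) (K : set T) (Lam : (T -> R) -> R).
Hypothesis meanLam : is_mean K Lam.

Lemma bounded_onB (g h : T -> R) : bounded_on K g -> bounded_on K h ->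
  bounded_on K (fun x => g x - h x).
Proof.
move=> [M gM] [N hN]; exists (M + N) => x Kx.
by rewrite (le_trans (ler_normB _ _))// lerD ?gM ?hN.
Qed.

(** Positivity and normalization make [Lam] 1-Lipschitz for the supremum norm on [K]; in particular
    only values on [K] matter. *)
Lemma mean_dist (g h : T -> R) (e : R) : bounded_on K g -> bounded_on K h ->
  (forall x, K x -> `|g x - h x| <= e) -> `|Lam g - Lam h| <= e.
Proof.
have [Lam1 LamD LamZ Lam0] := meanLam => bg bh ghe.
have b1 (c : R) : bounded_on K (fun=> c * 1) by exists `|c| => x _; rewrite mulr1.
have b1' : bounded_on K (fun=> 1 : R) by exists 1 => x _; rewrite normr1.
have H (g' h' : T -> R) : bounded_on K g' -> bounded_on K h' ->
    (forall x, K x -> `|g' x - h' x| <= e) -> Lam g' - Lam h' <= e.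
  move=> bg' bh' gh'.
  have bN : bounded_on K (fun x => (-1) * g' x).
    by case: bg' => M gM; exists M => x Kx; rewrite mulN1r normrN; exact: gM.
  have b2 : bounded_on K (fun x => h' x + (-1) * g' x).
    have [M] := bounded_onB bh' bg'; exists M => x Kx; rewrite mulN1r; exact: p.
  have : 0 <= Lam (fun x => (h' x + (-1) * g' x) + e * 1).
    apply: Lam0.
      have [M p] := b2; exists (M + `|e|) => x Kx.
      by rewrite (le_trans (ler_normD _ _))// lerD ?p// mulr1.
    by move=> x /gh'; rewrite ler_norml => /andP[]; lra.
  by rewrite !LamD// !LamZ// Lam1; lra.
rewrite ler_norml lerNl opprB; apply/andP; split; apply: H => // x Kx.
by rewrite distrC; exact: ghe.
Qed.

End MeanTheory.

(** * Nested cells and the quantile coupling *)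

Section Cells.
Variables (R : realType) (T : pointedType) (K : set T) (Lam : (T -> R) -> R).
Hypothesis meanLam : is_mean K Lam.
Variable F : nat -> set T.

Let w (E : set T) : R := Lam (\1_E).

(* Quantile coupling: the interval [[a, a + w E)] attached to the cell [E] is cut into
   consecutive intervals attached to [E `&` F k] and [E `\` F k], and so on [m] times;
   [cell] is the cell whose interval contains [u]. *)
Fixpoint cell (m k : nat) (E : set T) (a u : R) : set T :=
  match m with
  | 0%N => E
  | m'.+1 => if u < a + w (E `&` F k) then cell m' k.+1 (E `&` F k) a u
             else cell m' k.+1 (E `\` F k) (a + w (E `&` F k)) u
  end.

(** The same binary tree as in [cell], descended according to the position of [x] instead of that of
    [u]. *)
Fixpoint point_cell (m k : nat) (E : set T) (x : T) : set T :=
  match m with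
  | 0%N => E
  | m'.+1 => if x \in F k then point_cell m' k.+1 (E `&` F k) x
             else point_cell m' k.+1 (E `\` F k) x
  end.

Definition agree (m : nat) (x y : T) := forall i, (i < m)%N -> (F i x <-> F i y).

Lemma bounded_indic (E : set T) : bounded_on K (\1_E : T -> R).
Proof. by exists 1 => x _; rewrite indicE; case: (_ \in _); rewrite ?normr1 ?normr0. Qed.

Lemma cell_weightD (E G : set T) : w E = w (E `&` G) + w (E `\` G).
Proof.
have [_ LamD _ _] := meanLam.
rewrite /w -LamD; try exact: bounded_indic.
congr (Lam _); apply/funext => x; rewrite !indicE in_setI in_setD.
by case: (x \in E); case: (x \in G); rewrite /= ?addr0 ?add0r.
Qed.

Lemma cell_weight_ge0 E : 0 <= w E.
Proof.
have [_ _ _ Lam0] := meanLam; apply: Lam0; first exact: bounded_indic.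
by move=> x _; rewrite indicE ler0n.
Qed.

(** Intervals are half-open, so a cell of weight [0] owns an empty interval and is never
    selected. *)
Lemma cell_weight_gt0 m k E a u : a <= u < a + w E -> 0 < w (cell m k E a u).
Proof.
elim: m k E a => [|m IH] k E a /=.
  by move=> /andP[au]; move: au; lra.
move=> /andP[au ua]; case: (ltP u) => uF; apply: IH; rewrite ?au ?uF//.
by rewrite -addrA -cell_weightD.
Qed.

(** The indicator of a set disjoint from [K] vanishes on [K], so positivity applied to its opposite
    bounds the weight by [0]. *)
Lemma weight_gt0_meets E : 0 < w E -> exists x, E x /\ K x.
Proof.
move=> wE; apply: contrapT => nEK; have [_ _ LamZ Lam0] := meanLam.
have := LamZ (-1) _ (bounded_indic E).
have : 0 <= Lam (fun x => -1 * \1_E x).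
  apply: Lam0.
    by have [M p] := bounded_indic E; exists M => x /p; rewrite mulN1r normrN.
  move=> x Kx; rewrite indicE memNset ?mulr0// => Ex.
  by apply: nEK; exists x.
by move: wE; rewrite /w; lra.
Qed.

Lemma cell_subset m k E a u : cell m k E a u `<=` E.
Proof.
elim: m k E a => [|m IH] k E a /=; first by move=> x.
by case: ltP => _; apply: (subset_trans (IH _ _ _)) => x [].
Qed.

Lemma cell_nested m m' k E a u : (m <= m')%N -> cell m' k E a u `<=` cell m k E a u.
Proof.
elim: m m' k E a => [|m IH] m' k E a; first by move=> _; exact: cell_subset.
case: m' => [//|m'] /= mm'.
by case: ltP => _; apply: IH.
Qed.

Lemma cell_agree m k E a u x y : cell m k E a u x -> cell m k E a u y ->
  forall i, (k <= i < k + m)%N -> (F i x <-> F i y).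
Proof.
elim: m k E a => [|m IH] k E a /=.
  by move=> _ _ i; rewrite addn0 ltnNge; case: leqP.
case: ltP => _ xc yc i; rewrite leq_eqVlt addnS -addSn => /andP[/orP[/eqP <- _|ki im]].
- by have [_ ?] := cell_subset xc; have [_ ?] := cell_subset yc.
- by apply: (IH _ _ _ xc yc); rewrite ki.
- by have [_ ?] := cell_subset xc; have [_ ?] := cell_subset yc.
- by apply: (IH _ _ _ xc yc); rewrite ki.
Qed.

Lemma point_cell_mem m k (E : set T) x : E x -> point_cell m k E x x.
Proof.
elim: m k E => [//|m IH] k E Ex /=.
by case: ifPn => [/set_mem xF|/negP xF]; apply: IH; split=> // xF'; apply: xF; exact: mem_set.
Qed.

Lemma point_cell_subset m k E x : point_cell m k E x `<=` E.
Proof.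
elim: m k E => [|m IH] k E /=; first by move=> y.
by case: ifP => _; apply: (subset_trans (IH _ _)) => y [].
Qed.

Lemma point_cell_agree m k E x y z : point_cell m k E x y -> point_cell m k E x z ->
  forall i, (k <= i < k + m)%N -> (F i y <-> F i z).
Proof.
elim: m k E => [|m IH] k E /=.
  by move=> _ _ i; rewrite addn0 ltnNge; case: leqP.
case: ifP => _ xc yc i; rewrite leq_eqVlt addnS -addSn => /andP[/orP[/eqP <- _|ki im]].
- by have [_ ?] := point_cell_subset xc; have [_ ?] := point_cell_subset yc.
- by apply: (IH _ _ xc yc); rewrite ki.
- by have [_ ?] := point_cell_subset xc; have [_ ?] := point_cell_subset yc.
- by apply: (IH _ _ xc yc); rewrite ki.
Qed.

(** [u] enters only through finitely many threshold comparisons, so an arbitrary [H] on cells is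
    allowed. *)
Lemma measurable_cell d (Y : measurableType d) (H : set T -> Y) m k E a :
  measurable_fun [set: R] (fun u => H (cell m k E a u)).
Proof.
elim: m k E a => [|m IH] k E a /=; first exact: measurable_cst.
rewrite (_ : (fun u => _) = (fun u => if u < a + w (E `&` F k)
  then H (cell m k.+1 (E `&` F k) a u)
  else H (cell m k.+1 (E `\` F k) (a + w (E `&` F k)) u))); last first.
  by apply/funext => u; case: ifP.
by apply: measurable_fun_ifT => //; exact: measurable_fun_ltr.
Qed.

Lemma bounded_cell (H : set T -> R) m k E a :
  exists M, forall u, `|H (cell m k E a u)| <= M.
Proof.
elim: m k E a => [|m IH] k E a /=; first by exists `|H E|.
have [M1 p1] := IH k.+1 (E `&` F k) a.
have [M2 p2] := IH k.+1 (E `\` F k) (a + w (E `&` F k)).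
exists (Num.max M1 M2) => u; rewrite le_max.
by case: ltP => _; rewrite ?p1 ?p2 ?orbT.
Qed.

Lemma bounded_point_cell (H : set T -> R) m k E :
  bounded_on K (fun x => H (point_cell m k E x)).
Proof.
elim: m k E => [|m IH] k E /=; first by exists `|H E|.
have [M1 p1] := IH k.+1 (E `&` F k).
have [M2 p2] := IH k.+1 (E `\` F k).
exists (Num.max M1 M2) => u Ku; rewrite le_max.
by case: ifP => _; rewrite ?p1 ?p2 ?orbT.
Qed.

Lemma bounded_onM_indic (E : set T) (g : T -> R) : bounded_on K g ->
  bounded_on K (fun x => \1_E x * g x).
Proof.
move=> [M p]; exists M => x /p gM; rewrite indicE.
by case: (_ \in _); rewrite ?mul1r// mul0r normr0 (le_trans _ gM).
Qed.

Local Notation P := (uniform_prob (@ltr01 R)).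

Lemma uniform_prob_itvco (a b : R) : 0 <= a -> a <= b -> b <= 1 ->
  P `[a, b[%classic = (b - a)%:E.
Proof.
move=> a0 ab b1; rewrite /uniform_prob (eq_integral (fun=> 1%E)); last first.
  move=> x; rewrite inE/= in_itv/= => /andP[ax xb].
  by rewrite /uniform_pdf (le_trans a0 ax) (le_trans (ltW xb) b1) subr0 invr1.
rewrite integral_cst//= mul1e lebesgue_measure_itv/= lte_fin.
move: ab; rewrite le_eqVlt => /orP[/eqP ->|->]; last by rewrite EFinB.
by rewrite ltxx subrr.
Qed.

(** The exact transfer from [P] to [Lam] at a finite stage. At depth [0] both sides are [H E] times
    the weight of [E]; the inductive step cuts the interval at [c] and uses additivity of [Lam]. *)
Lemma Rintegral_cell (H : set T -> R) m k E a : 0 <= a -> a + w E <= 1 ->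
  \int[P]_(u in `[a, a + w E[%classic) H (cell m k E a u) =
  Lam (fun x => \1_E x * H (point_cell m k E x)).
Proof.
have [Lam1 LamD LamZ Lam0] := meanLam.
elim: m k E a => [|m IH] k E a a0 aE /=.
  rewrite Rintegral_cst//= uniform_prob_itvco//; last by rewrite lerDl cell_weight_ge0.
  rewrite /= addrAC subrr add0r -LamZ; last exact: bounded_indic.
  by congr (Lam _); apply/funext => x; rewrite mulrC.
pose c := a + w (E `&` F k).
have wE : a + w E = c + w (E `\` F k) by rewrite /c -addrA -cell_weightD.
have ac : a <= c by rewrite lerDl cell_weight_ge0.
have cE : c <= a + w E by rewrite wE lerDl cell_weight_ge0.
have -> : `[a, a + w E[%classic = `[a, c[%classic `|` `[c, a + w E[%classic :> set R.
  apply/seteqP; split => u /=; rewrite !in_itv/=.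
    by move=> /andP[au ub]; have [uc|cu] := ltP u c; [left|right]; rewrite ?au ?cu.
  case=> /andP[ua ub]; rewrite ?ua ?ub ?andbT/=; first exact: lt_le_trans cE.
  exact: le_trans ua.
pose g u := if u < c then H (cell m k.+1 (E `&` F k) a u)
            else H (cell m k.+1 (E `\` F k) c u).
have gE : (fun u => H (cell m.+1 k E a u)) = g.
  by apply/funext => u; rewrite /g /=; case: ifP.
have ig : P.-integrable (`[a, c[%classic `|` `[c, a + w E[%classic) (EFin \o g).
  rewrite -gE; apply: measurable_bounded_integrable.
  + exact: measurableU.
  + by rewrite (le_lt_trans (probability_le1 _ _)) ?ltry//; exact: measurableU.
  + exact: (measurable_funTS (@measurable_cell _ _ H m.+1 k E a)).
  + have [M p] := @bounded_cell H m.+1 k E a.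
    exists M; split; first by rewrite num_real.
    by move=> M' MM' u _; exact: le_trans (p u) (ltW MM').
rewrite (@eq_Rintegral _ _ _ P _ g); last by move=> u _; rewrite /g; case: ifP.
rewrite (Rintegral_setU _ _ ig)//; last first.
  rewrite disj_set2E; apply/eqP/seteqP; split=> // u [] /=; rewrite !in_itv/=.
  by move=> /andP[_ uc] /andP[]; rewrite leNgt uc.
transitivity (\int[P]_(u in `[a, c[%classic) H (cell m k.+1 (E `&` F k) a u) +
    \int[P]_(u in `[c, a + w E[%classic) H (cell m k.+1 (E `\` F k) c u)).
  congr (_ + _); apply: eq_Rintegral => u; rewrite inE/= in_itv/= /g.
    by move=> /andP[_ ->].
  by rewrite leNgt => /andP[/negPf ->].
rewrite wE !IH//.
- rewrite -LamD; try exact/bounded_onM_indic/bounded_point_cell.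
  congr (Lam _); apply/funext => x; rewrite !indicE in_setI in_setD.
  by case: (x \in E); case: (x \in F k); rewrite /= ?mul0r ?mul1r ?addr0 ?add0r.
- exact: le_trans ac.
- by rewrite -wE.
- by rewrite (le_trans cE).
Qed.

End Cells.

(** * Representing measures *)

Section MeanRepresentation.
Variables (R : realType) (n : nat).
Local Notation Rn' := 'rV[R]_n.
Variables (K : set Rn') (Lam : (Rn' -> R) -> R).
Hypothesis meanLam : is_mean K Lam.
Variable F : nat -> set Rn'.
Hypothesis Fsep : forall (j : 'I_n) (e : R), 0 < e -> exists m, forall x y,
  K x -> K y -> agree F m x y -> `|x ord0 j - y ord0 j| <= e.
Hypothesis closedK : closed K.

Local Notation P := (uniform_prob (@ltr01 R)).

Let w (E : set Rn') : R := Lam (\1_E).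

(** The default [0] is taken only when [E] misses [K], which cells of positive weight never do. *)
Definition cell_point (E : set Rn') : Rn' := xget 0 (E `&` K).

Lemma cell_pointP E : (exists x, E x /\ K x) -> E (cell_point E) /\ K (cell_point E).
Proof. by move=> [x EKx]; apply: (@xgetPex _ 0 (E `&` K)); exists x. Qed.

(** Sending the reals outside [[0, 1[] to [0] makes [approx] land in [K] everywhere; those reals are
    negligible for [P]. *)
Definition unit_clamp (u : R) : R := if (0 <= u) && (u < 1) then u else 0.

Definition approx (m : nat) (u : R) : Rn' :=
  cell_point (cell Lam F m 0 setT 0 (unit_clamp u)).

Lemma weightT : w setT = 1.
Proof. by have [L1 _ _ _] := meanLam; rewrite /w indicT. Qed.

Lemma unit_clampP u : 0 <= unit_clamp u < 0 + w setT.
Proof.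
rewrite weightT add0r /unit_clamp; case: ifP => //.
by rewrite lexx ltr01.
Qed.

Lemma measurable_unit_clamp : measurable_fun setT unit_clamp.
Proof.
apply: measurable_fun_ifT => //; apply: measurable_and.
  exact: measurable_fun_ler.
exact: measurable_fun_ltr.
Qed.

Lemma approx_cell m u : cell Lam F m 0 setT 0 (unit_clamp u) (approx m u).
Proof.
by have [] := cell_pointP (weight_gt0_meets meanLam
  (cell_weight_gt0 meanLam F m 0 (unit_clampP u))).
Qed.

Lemma approx_in m u : K (approx m u).
Proof.
by have [] := cell_pointP (weight_gt0_meets meanLam
  (cell_weight_gt0 meanLam F m 0 (unit_clampP u))).
Qed.

Lemma approx_agree m m1 m2 u : (m <= m1)%N -> (m <= m2)%N ->
  agree F m (approx m1 u) (approx m2 u).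
Proof.
move=> m1m m2m i im.
apply: (@cell_agree _ _ Lam F m 0 setT 0 (unit_clamp u)); last by rewrite add0n im.
  exact: (cell_nested m1m (approx_cell m1 u)).
exact: (cell_nested m2m (approx_cell m2 u)).
Qed.

Lemma agreeW m m' x y : (m <= m')%N -> agree F m' x y -> agree F m x y.
Proof. by move=> mm' H i im; apply: H; exact: leq_trans mm'. Qed.

Lemma agree_dist (e : R) : 0 < e -> exists m, forall x y, K x -> K y ->
  agree F m x y -> forall j, `|x ord0 j - y ord0 j| <= e.
Proof.
move=> e0; have /choice[f fP] : forall j, exists m, forall x y,
    K x -> K y -> agree F m x y -> `|x ord0 j - y ord0 j| <= e.
  by move=> j; exact: Fsep.
exists (\max_j f j)%N => x y Kx Ky xy j; apply: fP => //.
by apply: agreeW xy; exact: leq_bigmax.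
Qed.

Lemma approx_cauchy (e : R) : 0 < e -> exists m, forall m1 m2 u, (m <= m1)%N -> (m <= m2)%N ->
  forall j, `|approx m1 u ord0 j - approx m2 u ord0 j| <= e.
Proof.
move=> /agree_dist[m mP]; exists m => m1 m2 u mm1 mm2 j.
by apply: mP; [exact: approx_in|exact: approx_in|exact: approx_agree].
Qed.

Definition coupling (u : R) : Rn' := lim ((fun m => approx m u) @ \oo).

Lemma approx_cvg u : (fun m => approx m u) @ \oo --> coupling u.
Proof.
apply: mx_complete; apply: cauchy_exP => e e0.
have e2 : 0 < e / 2 by rewrite divr_gt0.
have [m mP] := approx_cauchy e2; exists (approx m u).
exists m => // m' /= mm'; split=> // i j; rewrite [i]ord1 /ball/=.
by rewrite (le_lt_trans (mP m m' u _ _ j))// gtr_pMr// invf_lt1// ltr1n.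
Qed.

Lemma coupling_in u : K (coupling u).
Proof.
apply: (closed_cvg K closedK _ _ (@approx_cvg u)).
by apply: nearW => m; exact: approx_in.
Qed.

(** The stage [m] does not depend on [u]; the measurability of the limit rests on this
    uniformity. *)
Lemma approx_unif (e : R) : 0 < e -> exists m, forall u, ball (approx m u) e (coupling u).
Proof.
move=> e0; have e4 : 0 < e / 4 by rewrite divr_gt0.
have e2 : 0 < e / 2 by rewrite divr_gt0.
have [m mP] := approx_cauchy e4; exists m => u; split=> // i j.
have -> : i = ord0 by rewrite (ord1 i).
have /cvg_ballP/(_ _ e2)[m' _ m'P] := @approx_cvg u.
have := (m'P (maxn m m') (leq_maxr _ _)).2 ord0 j.
have := mP m (maxn m m') u (leqnn _) (leq_maxl _ _) j.
rewrite /ball/= => h1 h2.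
rewrite (le_lt_trans (ler_distD (approx (maxn m m') u ord0 j) _ _))//.
by rewrite distrC in h2; lra.
Qed.

Lemma measurable_coupling : measurable_fun setT (coupling : R -> Rn R n).
Proof.
apply: (@measurability _ _ _ (Rn R n) setT coupling (@open Rn')) => //.
move=> _ [V oV <-]; rewrite setTI.
have inv_gt0 k : 0 < (k.+1%:R : R)^-1 by rewrite invr_gt0.
have /choice[f fP] k := approx_unif (inv_gt0 k).
pose B k := [set x : Rn' | ball x (k.+1%:R : R)^-1 `<=` V].
(* With [approx (f k)] uniformly within [1 / (k + 1)] of the limit, the limit lies in the open set
   [V] exactly when, for some [k], that ball around [approx (f k) u] fits inside [V]. Each such
   condition depends on [u] through a step function. *)
have -> : coupling @^-1` V = \bigcup_k [set u | B k (approx (f k) u)].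
  apply/seteqP; split=> u /=; last first.
    by move=> [k _ /= ]; apply; exact: fP.
  move=> Vu; have /nbhs_ballP[e /= e0 eV] : nbhs (coupling u) V by exact: open_nbhs_nbhs.
  have [k ke] : exists k, (k.+1%:R : R)^-1 < e / 2.
    have e2 : 0 < e / 2 by rewrite divr_gt0.
    have [N _ /(_ N (leqnn N)) NP] := near_infty_natSinv_lt (PosNum e2).
    by exists N.
  exists k => // x Bx; apply: eV.
  have := ball_triangle (ball_sym (fP k u)) Bx.
  by apply: le_ball; rewrite (splitr e) lerD// ltW.
apply: bigcup_measurable => k _.
have mB : measurable_fun setT (fun u => `[< B k (approx (f k) u) >]).
  have mB0 : measurable_fun setT
      (fun u => `[< B k (cell_point (cell Lam F (f k) 0 setT 0 u)) >]).
    exact: (@measurable_cell _ _ Lam F _ bool (fun E => `[< B k (cell_point E) >])).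
  exact: (measurableT_comp mB0 measurable_unit_clamp).
have := mB measurableT [set true] I; rewrite setTI.
by congr measurable; apply/seteqP; split=> u /= => [/asboolP|/asboolP ->].
Qed.

Definition cell_continuous (g : Rn' -> R) := forall e, 0 < e -> exists m, forall x y,
  K x -> K y -> agree F m x y -> `|g x - g y| <= e.

Lemma Rintegral_unit (g : R -> R) : P.-integrable setT (EFin \o g) ->
  \int[P]_(u in setT) g u = \int[P]_(u in `[0, 1[%classic) g u.
Proof.
move=> ig; pose I : set R := `[0, 1[%classic.
have P1 : P I = 1%E by rewrite uniform_prob_itvco// subr0.
rewrite /Rintegral (@negligible_integral _ _ _ P setT (~` I))//=.
- by congr (fine (integral _ _ _)); rewrite setTD setCK.
- by apply: measurableC; exact: measurable_itv.
- transitivity (1 - P I)%E; first by apply: probability_setC; exact: measurable_itv.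
  by rewrite P1 subee.
Qed.

Lemma integrable_bounded (g : R -> R) : measurable_fun setT g ->
  (exists M, forall u, `|g u| <= M) -> P.-integrable setT (EFin \o g).
Proof.
move=> mg [M gM]; apply: measurable_bounded_integrable => //.
  by rewrite (le_lt_trans (probability_le1 _ _)) ?ltry.
exists M; split; first by rewrite num_real.
by move=> M' MM' u _; exact: le_trans (gM u) (ltW MM').
Qed.

Lemma integrable_coupling (g : Rn' -> R) : bounded_on K g ->
  measurable_fun setT (g : Rn R n -> R) -> P.-integrable setT (EFin \o (g \o coupling)).
Proof.
move=> [M gM] mg; apply: integrable_bounded.
  exact: (measurableT_comp mg measurable_coupling).
by exists M => u /=; apply: gM; exact: coupling_in.
Qed.

(** Both sides are within [e / 2] of a step function at stage [m]: under [P] it is [h], under [Lam]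
    its [point_cell] version, and [Rintegral_cell] equates the two values. *)
Lemma Rintegral_coupling (g : Rn' -> R) : bounded_on K g -> cell_continuous g ->
  continuous g -> measurable_fun setT (g : Rn R n -> R) ->
  \int[P]_u (g (coupling u)) = Lam g.
Proof.
move=> bg cg contg mg; have ig := integrable_coupling bg mg.
rewrite (Rintegral_unit ig).
apply/eqP; rewrite -subr_eq0 -normr_eq0 eq_le normr_ge0 andbT.
apply/ler_addgt0Pr => e e0; rewrite add0r.
have e2 : 0 < e / 2 by rewrite divr_gt0.
have [m mP] := cg _ e2.
pose I := `[(0 : R), 1[%classic.
pose h u := g (cell_point (cell Lam F m 0 setT 0 u)).
have mh : measurable_fun setT h by exact: (@measurable_cell _ _ Lam F _ R (g \o cell_point)).
have ih : P.-integrable I (EFin \o h).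
  apply: (@integrableS _ _ _ P setT I) => //; first exact: measurable_itv.
  exact: (integrable_bounded mh (bounded_cell Lam F (g \o cell_point) m 0 setT 0)).
have igI : P.-integrable I (EFin \o (g \o coupling)).
  by apply: (@integrableS _ _ _ P setT I) => //; exact: measurable_itv.
have PI : P I = 1%E by rewrite uniform_prob_itvco// subr0.
have hI u : I u -> h u = g (approx m u).
  by rewrite /I/= in_itv/= => /andP[u0 u1]; rewrite /approx /unit_clamp u0 u1.
have near_h u : I u -> `|g (coupling u) - h u| <= e / 2.
  move=> Iu; rewrite (hI u Iu).
  (* The bound holds between stages [k >= m] and [m], and survives the limit in [k] because [g] is
     continuous. *)
  have gcvg : (fun k => `|g (approx k u) - g (approx m u)|) @ \oo -->
      `|g (coupling u) - g (approx m u)|.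
    apply: cvg_norm; apply: cvgB; last exact: cvg_cst.
    exact: (continuous_cvg _ (contg _) (@approx_cvg u)).
  apply: (closed_cvg (fun r : R => r <= e / 2) (@closed_le _ _) _ _ gcvg).
  exists m => // k /= mk; apply: mP; [exact: approx_in|exact: approx_in|].
  exact: approx_agree.
have d1 : `|\int[P]_(u in I) g (coupling u) - \int[P]_(u in I) h u| <= e / 2.
  rewrite -RintegralB//; last exact: measurable_itv.
  have iB : P.-integrable I (EFin \o (fun u => g (coupling u) - h u)).
    rewrite (_ : EFin \o _ = (EFin \o (g \o coupling)) \- (EFin \o h))%E//.
    by apply: integrableB => //; exact: measurable_itv.
  have mI : measurable (I : set (measurableTypeR R)) by exact: measurable_itv.
  apply: (le_trans (le_normr_Rintegral mI iB)).
  have -> : e / 2 = \int[P]_(u in I) (e / 2) by rewrite Rintegral_cst//= PI mulr1.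
  apply: le_Rintegral => //.
  - exact: integrable_norm.
  - by apply: finite_measure_integrable_cst.
have wT : 0 + w setT = 1 by rewrite weightT add0r.
have E : \int[P]_(u in I) h u =
    Lam (fun x => \1_setT x * g (cell_point (point_cell F m 0 setT x))).
  have wT1 : 0 + Lam \1_setT <= 1 by rewrite (wT : 0 + Lam \1_setT = 1).
  have := Rintegral_cell meanLam F (g \o cell_point) m 0 (lexx 0) wT1.
  by rewrite /= (wT : 0 + Lam \1_setT = 1).
have bp : bounded_on K (fun x => \1_setT x * g (cell_point (point_cell F m 0 setT x))).
  exact/bounded_onM_indic/(bounded_point_cell K F (g \o cell_point)).
have d2 : `|Lam (fun x => \1_setT x * g (cell_point (point_cell F m 0 setT x))) - Lam g|
    <= e / 2.
  apply: (mean_dist meanLam) => // x Kx.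
  rewrite indicT mul1r.
  have pxx : point_cell F m 0 setT x x by exact: point_cell_mem.
  have [px Kpx] := cell_pointP (ex_intro _ x (conj pxx Kx)).
  apply: mP => // i im; apply: (point_cell_agree px pxx).
  by rewrite add0n im.
rewrite (splitr e) -(subrK (\int[P]_(u in I) h u) (\int[P]_(u in I) _)) -addrA.
by rewrite (le_trans (ler_normD _ _))// lerD// E.
Qed.

Theorem mean_representation : exists mu : probability (Rn R n) R,
  [/\ mu (~` K) = 0%E,
      (forall g, bounded_on K g -> measurable_fun setT (g : Rn R n -> R) ->
         mu.-integrable setT (EFin \o g))
    & forall g, bounded_on K g -> cell_continuous g -> continuous g ->
        measurable_fun setT (g : Rn R n -> R) -> \int[mu]_x g x = Lam g].
Proof.
pose X : {mfun measurableTypeR R >-> Rn R n} := HB.pack (coupling : R -> Rn R n)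
  (isMeasurableFun.Build _ _ (measurableTypeR R) (Rn R n) coupling measurable_coupling).
exists (distribution P X); split.
(* [K] is closed, so limit points stay in it and the preimage of its complement is empty. *)
- rewrite /distribution/= /pushforward (_ : X @^-1` (~` K) = set0) ?measure0//.
  by apply/seteqP; split=> // u; apply; exact: coupling_in.
- move=> g bg mg; have /integrableP[_ fing] := integrable_coupling bg mg.
  apply/integrableP; split; first exact/measurable_EFinP.
  rewrite ge0_integral_distribution//.
  apply: measurableT_comp => //; exact/measurable_EFinP.
- move=> g bg cg contg mg; rewrite -(Rintegral_coupling bg cg contg mg) /Rintegral.
  rewrite integral_distribution//; first exact/measurable_EFinP.
  exact: integrable_coupling.
Qed.

End MeanRepresentation.

(** * The moment problem *)

Lemma threshold_separation (R : realType) (n : nat) :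
  exists F : nat -> set 'rV[R]_n, forall (K : set 'rV[R]_n),
    (forall j : 'I_n, bounded_on K (fun x => x ord0 j)) ->
    forall (j : 'I_n) (e : R), 0 < e -> exists m, forall x y, K x -> K y ->
      agree F m x y -> `|x ord0 j - y ord0 j| <= e.
Proof.
pose thr (t : 'I_n * nat * nat * nat) : set 'rV[R]_n :=
  let: (j, l, k, N) := t in [set x | x ord0 j + N%:R < l%:R / k.+1%:R].
pose F (i : nat) := if (choice.unpickle i : option ('I_n * nat * nat * nat)%type) is Some t
  then thr t else set0.
exists F => K bK j e e0.
have [M xM] := bK j.
pose N := Num.bound `|M|.
have NM : M <= N%:R.
  by rewrite (le_trans (ler_norm M))// ltW// archi_boundP.
have [k _ /(_ k (leqnn k)) ke] := near_infty_natSinv_lt (PosNum e0).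
(* Shifted and rescaled coordinates are at most [2 N (k + 1)]; the threshold used is one above their
   integer part, and ordinals below [B] are strict, hence the [2]. *)
pose B := (2 * N * k.+1).+2.
exists (\max_(l < B) (choice.pickle (j, l : nat, k, N)).+1)%N.
have key x y : K x -> K y ->
    agree F
      (\max_(l < B) (choice.pickle (j, l : nat, k, N)).+1)%N x y ->
    x ord0 j - y ord0 j <= e.
  move=> Kx Ky xy.
  have k0 : 0 < k.+1%:R :> R by [].
  have := xM _ Ky; rewrite ler_norml => /andP[y1 y2].
  (* The first grid point strictly above [y] exceeds it by at most [1 / (k + 1)]. By agreement [x]
     lies below that point too. *)
  pose z := (y ord0 j + N%:R) * k.+1%:R.
  have z0 : 0 <= z by rewrite mulr_ge0//; lra.
  have /andP[tz1 tz2] := truncn_itv z0.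
  have zB : z <= (2 * N * k.+1)%:R.
    by rewrite natrM ler_pM2r// natrM; lra.
  have lB : ((Num.truncn z).+1 < B)%N.
    by rewrite ltnS ltnS -(ler_nat R) (le_trans tz1).
  pose l := Ordinal lB.
  have := xy (choice.pickle (j, l : nat, k, N)).
  rewrite /F choice.pickleK /= => H.
  have : x ord0 j + N%:R < (Num.truncn z).+1%:R / k.+1%:R.
    apply/H; last by rewrite ltr_pdivlMr.
    exact: (@leq_bigmax _ (fun l : 'I_B => (choice.pickle (j, l : nat, k, N)).+1) l).
  have : (Num.truncn z).+1%:R / k.+1%:R <= y ord0 j + N%:R + k.+1%:R^-1.
    rewrite ler_pdivrMr// mulrDl mulVf ?gt_eqF// -natr1 lerD2r.
    exact: tz1.
  move=> h1 h2; have := lt_le_trans h2 h1; rewrite addrAC ltrD2r => h3.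
  by rewrite lerBlDl (le_trans (ltW h3))// lerD2l ltW.
move=> x y Kx Ky xy; rewrite ler_norml; apply/andP; split; last exact: key.
rewrite lerNl opprB; apply: key => // i im.
by have [h1 h2] := xy i im; split.
Qed.

Section PolynomialEvaluation.
Variables (R : comNzRingType) (I : choiceType) (v : I -> R).

Lemma pevalD p q : peval v (p + q) = peval v p + peval v q.
Proof. exact: rmorphD. Qed.

Lemma pevalM p q : peval v (p * q) = peval v p * peval v q.
Proof. exact: rmorphM. Qed.

Lemma pevalX p k : peval v (p ^+ k) = peval v p ^+ k.
Proof. exact: rmorphXn. Qed.

Lemma pevalC c : peval v c%:A = c.
Proof. by rewrite -pconstE peval_const. Qed.

Lemma pevalZ c p : peval v (c *: p) = c * peval v p.
Proof. by rewrite -mulr_algl pevalM pevalC. Qed.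

End PolynomialEvaluation.

(** * Compact sets, Putinar's theorem and representing measures *)

Section EvaluationRn.
Variables (R : realType) (n : nat).

Lemma continuous_evalRx (p : Rx R n) : continuous (fun x => evalRx x p).
Proof.
rewrite /evalRx; elim/polyring_ind: p => [c|j|p q cp cq|p q cp cq] x.
- rewrite (_ : (fun _ => _) = fun=> c); first exact: cst_continuous.
  by apply/funext => y; rewrite pevalC.
- rewrite (_ : (fun _ => _) = fun y : 'rV[R]_n => y ord0 j); first exact: coord_continuous.
  by apply/funext => y; rewrite peval_var.
- under eq_fun do rewrite pevalD.
  exact: (cvgD (cp x) (cq x)).
- under eq_fun do rewrite pevalM.
  exact: (cvgM (cp x) (cq x)).
Qed.

Lemma measurable_continuous (g : 'rV[R]_n -> R) : continuous g ->
  measurable_fun setT (g : Rn R n -> R).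
Proof.
move=> /continuousP cg; apply: (measurability _ (RGenOpens.measurableE R)).
move=> _ [_ [a [b ->]] <-]; rewrite setTI.
by apply: sub_sigma_algebra; apply: cg; exact: interval_open.
Qed.

Lemma measurable_evalRx (p : Rx R n) :
  measurable_fun setT (fun x : Rn R n => evalRx x p).
Proof. exact: measurable_continuous (@continuous_evalRx p). Qed.

Lemma closed_KS1 (S1 : set (Rx R n)) : closed (KS1 S1).
Proof.
rewrite (_ : KS1 S1 = \bigcap_(p in S1) [set X | 0 <= evalRx X p]) //.
apply: closed_bigI => p _.
apply: (@closed_comp _ _ (fun X => evalRx X p) [set r | 0 <= r]); last exact: closed_ge.
by move=> x _; exact: continuous_evalRx.
Qed.

Lemma measurable_KS1C (S1 : set (Rx R n)) : measurable (~` KS1 S1 : set (Rn R n)).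
Proof. by apply: sub_sigma_algebra; rewrite openC; exact: closed_KS1. Qed.

Variables (S1 : set (Rx R n)).
Local Notation K := (KS1 S1).

Lemma evalRx_QM1_ge0 x p : K x -> QM1 S1 p -> 0 <= evalRx x p.
Proof.
move=> Kx Qp; apply: (Qp [set q | 0 <= evalRx x q]); last by move=> q /Kx.
exact: (qmodule_preimage (peval (fun j => x ord0 j)) (@nonneg_qmodule R)).
Qed.

Hypothesis arch : qm_archimedean (QM1 S1).

Lemma bounded_evalRx p : bounded_on K (fun x => evalRx x p).
Proof.
have [N [N1 N2]] := arch p; exists N%:R => x Kx.
have := evalRx_QM1_ge0 Kx N1; have := evalRx_QM1_ge0 Kx N2.
rewrite /evalRx rmorphB rmorphD rmorph_nat ler_norml => h1 h2.
by apply/andP; split; lra.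
Qed.

Lemma bounded_coord_KS1 (j : 'I_n) : bounded_on K (fun x => x ord0 j).
Proof.
by have [M p] := bounded_evalRx (pvar R j); exists M => x /p; rewrite /evalRx peval_var.
Qed.

(** Putinar's Positivstellensatz: a character of the polynomial ring is evaluation at the images of
    the variables, and nonnegativity on [S1] puts this point in [K]. *)
Lemma nonneg_evalRx_QM1 p : (forall x, K x -> 0 <= evalRx x p) ->
  forall e, 0 < e -> QM1 S1 (p + e%:A).
Proof.
move=> ppos; apply: archimedean_positivstellensatz => //; first exact: qmgen_qmodule.
move=> phi phiC phi_ge0; pose X := \row_j phi (pvar R j).
have phiE : phi =1 evalRx X.
  apply: polyring_morph_ext => [c|j]; first by rewrite phiC /evalRx/= pevalC.
  by rewrite /evalRx/= peval_var mxE.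
rewrite phiE; apply: ppos => q S1q; rewrite -phiE; apply: phi_ge0.
exact: sub_qmgen.
Qed.

Lemma PK_integrable (mu : probability (Rn R n) R) (g : 'rV[R]_n -> R) :
  PK K mu -> bounded_on K g -> measurable_fun setT (g : Rn R n -> R) ->
  mu.-integrable setT (EFin \o g).
Proof.
move=> [_ muK] [M gM] mg.
have mK : measurable (K : set (Rn R n)) 
  by rewrite -[K]setCK; apply: measurableC; exact: measurable_KS1C.
apply: (@negligible_integrable _ _ _ mu setT (~` K) (EFin \o g)
  (measurable_KS1C S1) measurableT _ muK).2.
- exact/measurable_EFinP.
- rewrite setTD setCK; apply: measurable_bounded_integrable => //.
  + by rewrite (le_lt_trans (probability_le1 _ _)) ?ltry.
  + exact: measurable_funTS.
  + exists M; split; first by rewrite num_real.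
    by move=> M' MM' x Kx; exact: le_trans (gM x Kx) (ltW MM').
Qed.

Lemma PK_Rintegral_ge0 (mu : probability (Rn R n) R) (g : 'rV[R]_n -> R) :
  PK K mu -> mu.-integrable setT (EFin \o g) -> (forall x, K x -> 0 <= g x) ->
  0 <= \int[mu]_x g x.
Proof.
move=> [_ muK] ig gpos.
rewrite /Rintegral (@negligible_integral _ _ _ mu setT (~` K))//; last exact: measurable_KS1C.
by rewrite setTD setCK; exact: Rintegral_ge0.
Qed.

(* Haviland's theorem for the compact set [K]: positivity on [QM1 S1] passes to
   polynomials that are nonnegative on [K] by the Positivstellensatz. *)
Theorem moment_problem (L : Rx R n -> R) :
  (forall p q, L (p + q) = L p + L q) -> (forall c p, L (c *: p) = c * L p) ->
  L 1 = 1 -> (forall p, QM1 S1 p -> 0 <= L p) ->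
  exists mu : probability (Rn R n) R, PK K mu /\
    forall p, \int[mu]_x evalRx x p = L p.
Proof.
move=> LD LZ L1 Lpos.
have LK p : (forall x, K x -> 0 <= evalRx x p) -> 0 <= L p.
  move=> ppos; apply/ler_addgt0Pr => e e0.
  by have := Lpos _ (nonneg_evalRx_QM1 ppos e0); rewrite LD LZ L1 mulr1.
have [Lam meanLam LamE] : exists2 Lam, is_mean K Lam &
    forall p, Lam (fun x => evalRx x p) = L p.
  apply: (@mean_extension _ _ K _ (fun p x => evalRx x p) L 1) => //.
  - by move=> p q x; exact: pevalD.
  - by move=> c p x; exact: pevalZ.
  - by move=> x; exact: rmorph1.
  - exact: bounded_evalRx.
have [F /(_ K bounded_coord_KS1) Fsep] := threshold_separation R n.
have [mu [muK imu intmu]] := mean_representation meanLam Fsep (@closed_KS1 S1).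
have cc p : cell_continuous K F (fun x => evalRx x p).
  rewrite /evalRx; elim/polyring_ind: p => [c|j|p q cp cq|p q cp cq] e e0.
  - exists 0%N => x y _ _ _.
    by rewrite !pevalC subrr normr0 ltW.
  - by have [m mP] := Fsep j e e0; exists m => x y Kx Ky xy; rewrite !peval_var mP.
  - have e2 : 0 < e / 2 by rewrite divr_gt0.
    have [m1 p1] := cp _ e2; have [m2 p2] := cq _ e2.
    exists (maxn m1 m2) => x y Kx Ky xy; rewrite !pevalD opprD addrACA.
    rewrite (le_trans (ler_normD _ _))// (splitr e) lerD//.
      by apply: p1 => //; apply: agreeW xy; exact: leq_maxl.
    by apply: p2 => //; apply: agreeW xy; exact: leq_maxr.
  - have [A pA] := bounded_evalRx p; have [B qB] := bounded_evalRx q.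
    (* [A] and [B] may be negative when [K] is empty; this [C] is positive and bounds both factors
       in the product estimate. *)
    pose C := 1 + `|A| + `|B|.
    have C0 : 0 < C by rewrite /C; have := normr_ge0 A; have := normr_ge0 B; lra.
    have eC : 0 < e / (2 * C) by rewrite divr_gt0// mulr_gt0.
    have [m1 p1] := cp _ eC; have [m2 p2] := cq _ eC.
    exists (maxn m1 m2) => x y Kx Ky xy; rewrite !pevalM.
    have d1 := p1 x y Kx Ky (agreeW (leq_maxl _ _) xy).
    have d2 := p2 x y Kx Ky (agreeW (leq_maxr _ _) xy).
    have := pA x Kx; have := qB y Ky; rewrite /evalRx in d1 d2 *.
    set a := peval _ p; set a' := peval _ p; set b' := peval _ q; set b := peval _ q.
    move=> b'B aA; rewrite -/a -/a' in d1; rewrite -/b -/b' in d2.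
    have -> : a * b - a' * b' = a * (b - b') + (a - a') * b' by ring.
    rewrite (le_trans (ler_normD _ _))// !normrM.
    have -> : e = C * (e / (2 * C)) + (e / (2 * C)) * C by field; rewrite gt_eqF.
    have aC : `|a| <= C.
      by rewrite (le_trans aA)// (le_trans (ler_norm A))// /C; have := normr_ge0 B; lra.
    have bC : `|b'| <= C.
      by rewrite (le_trans b'B)// (le_trans (ler_norm B))// /C; have := normr_ge0 A; lra.
    by apply: lerD; apply: ler_pM.
exists mu; split.
  split=> // j k.
  have := imu _ (bounded_evalRx (pvar R j ^+ (2 * k))) (measurable_evalRx _).
  by congr (integrable _ _ _); apply/funext => x /=; rewrite /evalRx pevalX peval_var.
move=> p; rewrite intmu//; [exact: bounded_evalRx|exact: continuous_evalRx|].
exact: measurable_evalRx.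
Qed.

End EvaluationRn.

(** * Formal moments *)

Lemma rmorph_monval (S S' : comNzRingType) (I : choiceType) (f : {rmorphism S -> S'})
  (v : I -> S) (k : cmonom I) : f (monval v k) = monval (f \o v) k.
Proof. by rewrite /monval rmorph_prod; apply: eq_bigr => i _; rewrite rmorphXn. Qed.

(** The splitting into a moment factor and a factor in [x] mirrors [mlin_mon]. *)
Lemma monval_sum (S : comNzRingType) (I : choiceType) (J : finType)
  (a : I -> S) (b : J -> S) (k : cmonom (I + J)%type) :
  monval (fun i => match i with inl i => a i | inr j => b j end) k =
  monval (fun i => match i with inl i => a i | inr _ => 1 end) k *
  \prod_j b j ^+ cmonom_val k (inr j).
Proof.
elim/cmonom_ind: k => [|i k IH].
  by rewrite !monval1 mul1r big1// => j _; rewrite onecmE expr0.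
have E j : b j ^+ cmonom_val (mulcm (ucm i) k) (inr j) =
    b j ^+ (i == inr j) * b j ^+ cmonom_val k (inr j).
  by rewrite -exprD; congr (_ ^+ _); rewrite -ucmE; exact: mulcmE.
rewrite !monvalM !monvalU IH (eq_bigr _ (fun j _ => E j)) big_split/=.
set v := (X in X * _ = _); set v' := (X in _ = X * _ * _); set e := (X in _ = _ * (X * _)).
suff -> : v = v' * e by ring.
rewrite /v /v' /e; case: i {E v v' e} => [i|j0]; first by rewrite big1 ?mulr1.
rewrite mul1r (bigD1 j0)//= eqxx big1 ?mulr1// => j.
by rewrite (inj_eq inr_inj) eq_sym => /negPf ->.
Qed.

Lemma alg_mulA (R : pzRingType) (A : lalgType R) (c d : R) (x : A) :
  (c * d)%:A * x = c *: (d%:A * x).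
Proof. by rewrite !mulr_algl scalerA. Qed.

Lemma affine_linear_morph (R : pzRingType) (A B : lalgType R) (l : A -> B) (N : nat) (x : A) :
  (forall y z, l (y + z) = l y + l z) -> (forall c y, l (c *: y) = c *: l y) -> l 1 = 1 ->
  l (N%:R + x) = N%:R + l x /\ l (N%:R - x) = N%:R - l x.
Proof.
move=> lD lZ l1; have lN : l N%:R = N%:R by rewrite -[N%:R]scaler_nat lZ l1 scaler_nat.
by split; rewrite lD lN// -scaleN1r lZ scaleN1r.
Qed.

(** [h] is not assumed multiplicative, as [mlin_mon] is not, so linearity is checked on
    coefficients. *)
Lemma mmap_pconstZ (R : comNzRingType) (I J : choiceType)
  (h : cmonom I -> polyring R J) (c : R) (f : polyring R I) :
  monalg.mmap (@pconst R J) h (c *: f) = c *: monalg.mmap (@pconst R J) h f.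
Proof.
rewrite (mmapEw (msuppZ_le c f)) mmapE scaler_sumr; apply: eq_bigr => k _.
transitivity ((c * monalg.mcoeff k f)%:A * h k); first by rewrite mcoeffZ -pconstE.
by rewrite pconstE; exact: alg_mulA.
Qed.

Lemma sqr_mul_rmorph (A B : comNzRingType) (f : {rmorphism A -> B}) (g : B) (a q : A) :
  g ^+ 2 * f (a ^+ 2 * q) = (g * f a) ^+ 2 * f q.
Proof. by rewrite rmorphM rmorphXn exprMn mulrA. Qed.

Section FormalMoments.
Variables (R : realType) (n : nat).

Lemma mlinD (f g : Mx R n) : mlin (f + g) = mlin f + mlin g.
Proof. by rewrite /mlin raddfD. Qed.

Lemma mlinU c (k : cmonom (momvar n + 'I_n)%type) :
  mlin (mkmalgU k c : Mx R n) = c *: mlin_mon R k.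
Proof. by rewrite /mlin mmapU/= pconstE mulr_algl. Qed.

Lemma mlinZ c (f : Mx R n) : mlin (c *: f) = c *: mlin f.
Proof. exact: mmap_pconstZ. Qed.

Lemma momE (b : momvar n) : mom R (val b) = pvar R b.
Proof. by rewrite /mom valK. Qed.

Lemma Rx_to_Mx_monomial (k : cmonom 'I_n) : exists k' : cmonom (momvar n + 'I_n)%type,
  [/\ Rx_to_Mx (mkmalgU k 1) = mkmalgU k' 1 :> Mx R n,
      (forall b, cmonom_val k' (inl b) = 0%N)
    & (forall j, cmonom_val k' (inr j) = cmonom_val k j)].
Proof.
rewrite /Rx_to_Mx psubstU; elim/cmonom_ind: k => [|i k [k' [E k'l k'r]]].
  by exists (onecm _); rewrite monval1; split=> // x; rewrite !onecmE.
exists (mulcm (ucm (inr i)) k'); split.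
- by rewrite monvalM E monvalU mkmalgUM.
- by move=> b; rewrite (mulcmE (ucm (inr i)) k' (inl b)) k'l addn0 ucmE.
- move=> j; rewrite (mulcmE (ucm (inr i)) k' (inr j)) (mulcmE (ucm i) k j) k'r !ucmE.
  by rewrite (inj_eq inr_inj).
Qed.

Lemma mlin_Rx_monomial (k : cmonom 'I_n) :
  mlin (Rx_to_Mx (mkmalgU k 1 : Rx R n)) = mom R [ffun j => cmonom_val k j].
Proof.
have [k' [-> k'l k'r]] := Rx_to_Mx_monomial k.
rewrite mlinU scale1r /mlin_mon /monval big1_fset ?mul1r.
  by congr (mom _ _); apply/ffunP => j; rewrite !ffunE k'r.
by move=> [b|j] _ _; rewrite ?k'l ?expr0 ?expr1n.
Qed.

Lemma Rx_to_Mx1 : Rx_to_Mx (1 : Rx R n) = 1.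
Proof. exact: rmorph1. Qed.

Lemma Rx_to_MxD (p q : Rx R n) : Rx_to_Mx (p + q) = Rx_to_Mx p + Rx_to_Mx q.
Proof. exact: rmorphD. Qed.

Lemma Rx_to_MxM (p q : Rx R n) : Rx_to_Mx (p * q) = Rx_to_Mx p * Rx_to_Mx q.
Proof. exact: rmorphM. Qed.

Lemma Rx_to_MxC c : Rx_to_Mx (c%:A : Rx R n) = c%:A.
Proof. by rewrite -pconstE /Rx_to_Mx psubst_const pconstE. Qed.

Lemma Rx_to_MxZ c (p : Rx R n) : Rx_to_Mx (c *: p) = c *: Rx_to_Mx p.
Proof. by rewrite -mulr_algl Rx_to_MxM Rx_to_MxC mulr_algl. Qed.

Lemma mlin1 : mlin (1 : Mx R n) = 1.
Proof.
have -> : 1 = mkmalgU (onecm _) 1 :> Mx R n by [].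
(* At the zero index [insub] fails, which encodes the convention that this moment is [1]. *)
rewrite mlinU scale1r /mlin_mon monval1 mul1r /mom insubN//= negbK.
by apply/eqP/ffunP => j; rewrite !ffunE onecmE.
Qed.

Variables (S1 : set (Rx R n)) (S2 : set (Mr R n)).

(** The square of [g] must stay arbitrary in the induction on [QM1 S1]: multiplying [p] by [a ^+ 2]
    replaces [g] by [g * Rx_to_Mx a]. *)
Lemma qm2_mlin_QM1 p (g : Mx R n) : QM1 S1 p ->
  qm2 S1 S2 (mlin (g ^+ 2 * Rx_to_Mx p)).
Proof.
move=> Qp; move: g.
apply: (Qp [set p | forall g : Mx R n, qm2 S1 S2 (mlin (g ^+ 2 * Rx_to_Mx p))]).
  have qmq : is_qmodule (qm2 S1 S2) by exact: qmgen_qmodule.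
  split=> [g|q r Qq Qr g|a q Qq g].
  - apply: sub_qmgen; left; exists g, (Rx_to_Mx 1); split=> //; left.
    by rewrite /= Rx_to_Mx1.
  - rewrite Rx_to_MxD.
    rewrite mulrDr.
    rewrite mlinD.
    case: qmq => _ qD _.
    apply: qD; [exact: Qq|exact: Qr].
  - have -> : g ^+ 2 * Rx_to_Mx (a ^+ 2 * q) = (g * Rx_to_Mx a) ^+ 2 * Rx_to_Mx q.
      exact: (sqr_mul_rmorph (psubst (fun j => pvar R (inr j)))).
    exact: Qq.
move=> q S1q g; apply: sub_qmgen; left; exists g, (Rx_to_Mx q); split=> //.
by right; exists q.
Qed.

Lemma qm2_mlin_Rx p : QM1 S1 p -> qm2 S1 S2 (mlin (Rx_to_Mx p)).
Proof. by move=> /(qm2_mlin_QM1 1); rewrite expr1n mul1r. Qed.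

Lemma QM2_Rx p : QM1 S1 p -> QM2 S1 S2 (Rx_to_Mx p).
Proof.
move=> Qp; refine (Qp (@Rx_to_Mx R n @^-1` QM2 S1 S2) _ _).
  exact: (qmodule_preimage (psubst _) (qmgen_qmodule _)).
by move=> q S1q; apply: sub_qmgen; left; exists q.
Qed.

Lemma QM2_Mr g : qm2 S1 S2 g -> QM2 S1 S2 (Mr_to_Mx g).
Proof.
move=> Qg; refine (Qg (@Mr_to_Mx R n @^-1` QM2 S1 S2) _ _).
  exact: (qmodule_preimage (psubst _) (qmgen_qmodule _)).
by move=> q S1q; apply: sub_qmgen; right; exists q.
Qed.

Hypothesis arch : qm_archimedean (QM1 S1).

Lemma qm2_archimedean : qm_archimedean (qm2 S1 S2).
Proof.
apply: archimedean_polyring => [|b]; first exact: qmgen_qmodule.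
have [k kb] := cmonom_fin (val b).
have kE : mlin (Rx_to_Mx (mkmalgU k 1 : Rx R n)) = pvar R b.
  rewrite mlin_Rx_monomial -momE; congr (mom _ _).
  by apply/ffunP => j; rewrite ffunE kb.
pose l (p : Rx R n) := mlin (Rx_to_Mx p).
have lD p q : l (p + q) = l p + l q by rewrite /l Rx_to_MxD mlinD.
have lZ c p : l (c *: p) = c *: l p by rewrite /l Rx_to_MxZ mlinZ.
have l1 : l 1 = 1 by exact: etrans (congr1 (@mlin R n) Rx_to_Mx1) mlin1.
have [N [/qm2_mlin_Rx N1 /qm2_mlin_Rx N2]] := arch (mkmalgU k 1).
have [E1 E2] := affine_linear_morph N (mkmalgU k 1) lD lZ l1.
exists N; rewrite -kE -[mlin _]/(l _); split.
  by rewrite -E1; exact: N1.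
by rewrite -E2; exact: N2.
Qed.

Lemma QM2_archimedean : qm_archimedean (QM2 S1 S2).
Proof.
apply: archimedean_polyring => [|[b|j]]; first exact: qmgen_qmodule.
  have [N [/QM2_Mr N1 /QM2_Mr N2]] := qm2_archimedean (pvar R b).
  exists N; move: N1 N2; rewrite /Mr_to_Mx.
  by rewrite (rmorphD (psubst _)) (rmorphB (psubst _)) (rmorph_nat (psubst _)) /= psubst_var.
have [N [/QM2_Rx N1 /QM2_Rx N2]] := arch (pvar R j).
exists N; move: N1 N2; rewrite /Rx_to_Mx.
by rewrite (rmorphD (psubst _)) (rmorphB (psubst _)) (rmorph_nat (psubst _)) /= psubst_var.
Qed.

(** The functional [p |-> psi (mlin (Rx_to_Mx p))] has a representing measure, whose moments are the
    values of [psi] on the moment variables. *)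
Lemma qm2_character (psi : {rmorphism Mr R n -> R}) : (forall c, psi c%:A = c) ->
  (forall g, qm2 S1 S2 g -> 0 <= psi g) ->
  exists2 mu : probability (Rn R n) R, KS12 S1 S2 mu & psi =1 evalM mu.
Proof.
move=> psiC psi_ge0.
have psiZ c g : psi (c *: g) = c * psi g by rewrite -mulr_algl rmorphM/= psiC.
have [|||p Qp|mu [muP intmu]] := moment_problem arch
    (L := fun p => psi (mlin (Rx_to_Mx p))).
- by move=> p q; rewrite Rx_to_MxD mlinD rmorphD.
- by move=> c p; rewrite Rx_to_MxZ mlinZ psiZ.
- by rewrite Rx_to_Mx1 mlin1 rmorph1.
- by apply: psi_ge0; exact: qm2_mlin_Rx.
have psiE : psi =1 evalM mu.
  apply: polyring_morph_ext => [c|b]; first by rewrite psiC; apply: esym; exact: pevalC.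
  transitivity (moment mu (val b)); last by apply: esym; exact: peval_var.
  have [k kb] := cmonom_fin (val b).
  rewrite -momE (_ : val b = [ffun j => cmonom_val k j]); last first.
    by apply/ffunP => j; rewrite ffunE kb.
  rewrite -mlin_Rx_monomial -intmu; apply: eq_Rintegral => x _.
  rewrite /evalRx pevalU mul1r monval_fin /xmon.
  by apply: eq_bigr => j _; rewrite ffunE.
exists mu => //; split=> // s S2s; rewrite -psiE; apply: psi_ge0.
by apply: sub_qmgen; right.
Qed.

(** Restriction to the moment polynomials yields [mu]; the images of the variables [x_j] yield
    [X]. *)
Lemma QM2_character (phi : {rmorphism Mx R n -> R}) : (forall c, phi c%:A = c) ->
  (forall g, QM2 S1 S2 g -> 0 <= phi g) ->
  exists (mu : probability (Rn R n) R) (X : 'rV[R]_n),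
    [/\ KS12 S1 S2 mu, KS1 S1 X & phi =1 evalMx mu X].
Proof.
move=> phiC phi_ge0.
have Mr_to_MxC c : Mr_to_Mx (c%:A : Mr R n) = c%:A.
  by rewrite -pconstE /Mr_to_Mx psubst_const pconstE.
have [|g /QM2_Mr /phi_ge0//|mu muP psiE] :=
    qm2_character (psi := phi \o psubst (fun b => pvar R (inl b))).
  by move=> c /=; rewrite -[psubst _ _]/(Mr_to_Mx _) Mr_to_MxC phiC.
pose X := \row_j phi (pvar R (inr j)).
have phiE : phi =1 evalMx mu X.
  apply: polyring_morph_ext => [c|[b|j]]; first by rewrite phiC; apply: esym; exact: pevalC.
    have := psiE (pvar R b); rewrite /= psubst_var => ->.
    by rewrite /evalM /evalMx/= !peval_var.
  by rewrite /evalMx/= peval_var mxE.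
exists mu, X; split=> // p S1p.
have -> : evalRx X p = phi (Rx_to_Mx p).
  have E : peval (fun j => X ord0 j) =1 (phi \o psubst (fun j => pvar R (inr j))).
    apply: polyring_morph_ext => [c|j].
      exact: etrans (pevalC _ _) (esym (etrans (congr1 phi (Rx_to_MxC c)) (phiC c))).
    by rewrite /= peval_var mxE psubst_var.
  exact: E.
by apply: phi_ge0; apply: QM2_Rx; exact: sub_qmgen.
Qed.

End FormalMoments.

(** * Soundness *)

Section Soundness.
Variables (R : realType) (n : nat) (S1 : set (Rx R n)) (S2 : set (Mr R n)).
Hypothesis arch : qm_archimedean (QM1 S1).
Local Notation K := (KS1 S1).
Variable mu : probability (Rn R n) R.
Hypothesis muK : PK K mu.

Lemma xmonE (a : mindex n) : exists p : Rx R n, forall x, evalRx x p = xmon a x.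
Proof.
have [k ka] := cmonom_fin a; exists (mkmalgU k 1) => x.
rewrite /evalRx pevalU mul1r monval_fin /xmon.
by apply: eq_bigr => j _; rewrite ka.
Qed.

Lemma integrable_xmon (a : mindex n) : mu.-integrable setT (EFin \o xmon a).
Proof.
have [p pE] := xmonE a.
have -> : xmon a = fun x => evalRx x p by apply/funext => x; rewrite pE.
by apply: (PK_integrable muK); [exact: bounded_evalRx|exact: measurable_evalRx].
Qed.

Lemma evalM_mom (a : mindex n) : evalM mu (mom R a) = moment mu a.
Proof.
rewrite /mom; case: insubP => [b _ ba|]; first by rewrite /evalM peval_var ba.
rewrite negbK => /eqP ->; rewrite /evalM rmorph1 /moment.
rewrite (@eq_Rintegral _ _ _ mu setT (fun=> 1)).
  by rewrite Rintegral_cst//= probability_setT mul1r.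
by move=> x _; rewrite /xmon big1// => j _; rewrite ffunE expr0.
Qed.

(** The formal map [mlin] becomes integration in [x]. Integrability is carried along because the sum
    step needs it. *)
Lemma evalM_mlin (f : Mx R n) :
  mu.-integrable setT (EFin \o (fun x => evalMx mu x f)) /\
  evalM mu (mlin f) = \int[mu]_x evalMx mu x f.
Proof.
rewrite (monalgE f); pose v (x : 'rV[R]_n) (i : momvar n + 'I_n) : R :=
  match i with inl b => moment mu (val b) | inr j => x ord0 j end.
pose Q g := mu.-integrable setT (EFin \o (fun x => evalMx mu x g)) /\
  evalM mu (mlin g) = \int[mu]_x evalMx mu x g.
have evD x (g h : Mx R n) : evalMx mu x (g + h) = evalMx mu x g + evalMx mu x h.
  exact: pevalD.
have QD g h : Q g -> Q h -> Q (g + h).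
  move=> [ig Eg] [ih Eh]; split.
    have -> : EFin \o (fun x => evalMx mu x (g + h)) =
        ((EFin \o (fun x => evalMx mu x g)) \+ (EFin \o (fun x => evalMx mu x h)))%E.
      by apply/funext => x /=; rewrite evD EFinD.
    exact: integrableD.
  rewrite mlinD /evalM pevalD [LHS](congr2 +%R Eg Eh) -RintegralD//.
  by apply: eq_Rintegral => x _; rewrite evD.
have QU c k : Q (mkmalgU k c).
  pose a : mindex n := [ffun j => cmonom_val k (inr j)].
  pose A := monval (fun i : momvar n + 'I_n =>
    match i with inl b => moment mu (val b) | inr _ => 1 end) k.
  have E x : evalMx mu x (mkmalgU k c) = (c * A) * xmon a x.
    rewrite /evalMx pevalU monval_sum -/A mulrA; congr (_ * _).
    by apply: eq_bigr => j _; rewrite ffunE.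
  split.
    have -> : EFin \o (fun x => evalMx mu x (mkmalgU k c)) =
        (fun x => (c * A)%:E * (EFin \o xmon a) x)%E.
      by apply/funext => x /=; rewrite E EFinM.
    by apply: integrableZl => //; exact: integrable_xmon.
  under eq_Rintegral do rewrite E.
  rewrite RintegralZl//; last exact: integrable_xmon.
  rewrite mlinU /evalM pevalZ -mulrA; congr (_ * _).
  rewrite /mlin_mon pevalM -/a; congr (_ * _); last exact: evalM_mom.
  rewrite (rmorph_monval (peval (fun b => moment mu (val b)))) /A /monval.
  by apply: eq_bigr => -[b|j] _; congr (_ ^+ _); [exact: peval_var|exact: rmorph1].
have Q0 : Q 0.
  by have := QU 0 (onecm _); rewrite monalgU0.
by apply: (big_ind Q) => // k _; exact: QU.
Qed.

Lemma evalMx_Rx (X : 'rV[R]_n) p : evalMx mu X (Rx_to_Mx p) = evalRx X p.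
Proof.
have E : (peval (fun i : momvar n + 'I_n => match i with
    inl b => moment mu (val b) | inr j => X ord0 j end) \o
    psubst (fun j => pvar R (inr j))) =1 peval (fun j => X ord0 j).
  apply: polyring_morph_ext => [c|j]; last by rewrite /= psubst_var !peval_var.
  exact: etrans (congr1 _ (Rx_to_MxC n c)) (etrans (pevalC _ _) (esym (pevalC _ _))).
exact: E.
Qed.

Lemma evalMx_Mr (X : 'rV[R]_n) g : evalMx mu X (Mr_to_Mx g) = evalM mu g.
Proof.
have E : (peval (fun i : momvar n + 'I_n => match i with
    inl b => moment mu (val b) | inr j => X ord0 j end) \o
    psubst (fun b => pvar R (inl b))) =1 peval (fun b : momvar n => moment mu (val b)).
  apply: polyring_morph_ext => [c|j]; last by rewrite /= psubst_var !peval_var.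
  have C : Mr_to_Mx (c%:A : Mr R n) = c%:A by rewrite -pconstE /Mr_to_Mx psubst_const pconstE.
  exact: etrans (congr1 _ C) (etrans (pevalC _ _) (esym (pevalC _ _))).
exact: E.
Qed.

(** A generator evaluates to the integral of a square times a function nonnegative on [K]. *)
Lemma mgens_ge0 y : mgens S1 y -> 0 <= evalM mu y.
Proof.
move=> [f [s [Ss ->]]]; have [ifs ->] := evalM_mlin (f ^+ 2 * s).
apply: (PK_Rintegral_ge0 muK ifs) => x Kx.
rewrite /evalMx pevalM pevalX mulr_ge0 ?sqr_ge0//.
case: Ss => [->|[p S1p <-]]; first by rewrite rmorph1.
have := evalMx_Rx x p; rewrite /evalMx => ->; exact: Kx.
Qed.

Hypothesis muS2 : forall s, S2 s -> 0 <= evalM mu s.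

Lemma qm2_ge0 g : qm2 S1 S2 g -> 0 <= evalM mu g.
Proof.
move=> Qg; refine (Qg [set g | 0 <= evalM mu g] _ _).
  exact: (qmodule_preimage (peval _) (@nonneg_qmodule R)).
by move=> y [/mgens_ge0|/muS2].
Qed.

Lemma QM2_ge0 (X : 'rV[R]_n) g : K X -> QM2 S1 S2 g -> 0 <= evalMx mu X g.
Proof.
move=> KX Qg; refine (Qg [set g | 0 <= evalMx mu X g] _ _).
  exact: (qmodule_preimage (peval _) (@nonneg_qmodule R)).
move=> _ [[p S1p <-]|[y Sy <-]].
  by rewrite /= evalMx_Rx; exact: KX.
by rewrite /= evalMx_Mr; apply: qm2_ge0; exact: sub_qmgen.
Qed.

End Soundness.

Theorem theorem4p2 (R : realType) (n : nat)
    (S1 : set (Rx R n)) (S2 : set (Mr R n)) :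
  qm_archimedean (QM1 S1) ->
  (forall f : Mx R n,
     (forall (mu : probability (Rn R n) R) (X : 'rV[R]_n),
        KS12 S1 S2 mu -> KS1 S1 X -> 0 <= evalMx mu X f)
     <->
     (forall eps : R, 0 < eps -> QM2 S1 S2 (f + @pconst _ _ eps)))
  /\
  (forall f : Mr R n,
     (forall mu : probability (Rn R n) R, KS12 S1 S2 mu -> 0 <= evalM mu f)
     <->
     (forall eps : R, 0 < eps -> qm2 S1 S2 (f + @pconst _ _ eps))).
Proof.
move=> arch; split=> f; split.
- move=> fpos eps eps0; rewrite pconstE; move: eps eps0.
  apply: archimedean_positivstellensatz; [exact: qmgen_qmodule|exact: QM2_archimedean|].
  move=> phi phiC phi_ge0.
  have [mu [X [muP XP ->]]] := QM2_character arch phiC phi_ge0.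
  exact: fpos.
- move=> fQ mu X [muK muS2] KX; apply/ler_addgt0Pr => e e0.
  have := QM2_ge0 arch muK muS2 KX (fQ e e0).
  by rewrite /evalMx pevalD peval_const.
- move=> fpos eps eps0; rewrite pconstE; move: eps eps0.
  apply: archimedean_positivstellensatz; [exact: qmgen_qmodule|exact: qm2_archimedean|].
  move=> phi phiC phi_ge0.
  have [mu muP ->] := qm2_character arch phiC phi_ge0.
  exact: fpos.
- move=> fQ mu [muK muS2]; apply/ler_addgt0Pr => e e0.
  have := qm2_ge0 arch muK muS2 (fQ e e0).
  by rewrite /evalM pevalD peval_const.
Qed.
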